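(* For each fixed $n \ge 1$, $$\mathcal{E}_n(G_1; H) \asymp H^n\log H,$$ and for each fixed $n \ge 2$, $$\mathcal{E}_n^{\mathrm{monic}}(G_1;H) \asymp H^{n-1}\log H.$$
   Context: A polynomial $f$ of degree $2n$ is reciprocal if $x^{2n}f(1/x) = f(x)$; for such $f\in\mathbb{Z}[x]$ there is a unique $g\in\mathbb{Z}[u]$ of degree $n$ with $f(x) = x^n g(x+1/x)$. $G_g$ denotes the Galois group of $g$ over $\mathbb{Q}$ (a subgroup of $S_n$ acting on the roots of $g$), and $G_f$ the Galois group of $f$ over $\mathbb{Q}$, which (for separable $f$) is viewed as a subgroup, up to conjugacy, of the wreath product $S_2\wr S_n = \mathbb{F}_2^n\rtimes S_n$ of permutations of the roots of $f$ preserving the partition into pairs $\{\alpha,1/\alpha\}$ ($S_n$ permutes the pairs, and $\mathbb{F}_2^n$ swaps elements within the pairs). $G_1 = \{(\mathbf{v},\sigma)\in\mathbb{F}_2^n\rtimes S_n : \sum_i v_i = 0\}$. For a subgroup $G\subseteq S_2\wr S_n$ and $H\ge 2$, $\mathcal{E}_n(G;H)$ is the number of separable reciprocal polynomials $f\in\mathbb{Z}[x]$ of degree $2n$ with all coefficients in $[-H,H]$ such that $G_g = S_n$ and $G_f$ is (conjugate to) a subgroup of $G$; $\mathcal{E}_n^{\mathrm{monic}}(G;H)$ counts those that are moreover monic. $A(H)\asymp B(H)$ means $c_1|B(H)|\le|A(H)|\le c_2|B(H)|$ for all sufficiently large $H$, with constants $c_1,c_2>0$ depending only on $n$. *)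

(* Defs.v *)
From HB Require Import structures.
From mathcomp Require Import all_boot all_order all_fingroup all_algebra all_field.
From mathcomp Require Import finmap.
From mathcomp Require Import all_classical all_reals all_analysis.

Set Implicit Arguments.
Unset Strict Implicit.
Unset Printing Implicit Defensive.

Import Order.TTheory GRing.Theory Num.Theory.
Local Open Scope ring_scope.
Local Open Scope classical_set_scope.

Section IntegerPolynomials.

Definition evalZ (K : nzRingType) (f : {poly int}) (y : K) : K :=
  (map_poly intr f).[y].

(* The indeterminate x in the function field Frac(Z[x]). *)
Definition xF : {fraction {poly int}} := tofrac 'X.

Definition reciprocal (n : nat) (f : {poly int}) : Prop :=
  xF ^+ (2 * n) * evalZ f xF^-1 = evalZ f xF.

(* For each reciprocal f of degree 2n exactly one g satisfies this. *)
Definition trace_poly (n : nat) (f g : {poly int}) : Prop :=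
  size g = n.+1 /\ evalZ f xF = xF ^+ n * evalZ g (xF + xF^-1).

Definition separableZ (f : {poly int}) : Prop :=
  separable_poly (map_poly intr f : {poly rat}).

End IntegerPolynomials.

Section GaloisGroups.

Definition splits_over (f : {poly int}) (L : splittingFieldType rat) : Prop :=
  splittingFieldFor 1%VS (map_poly intr f : {poly L}) {:L}%VS.

Definition root_labelling (L : fieldType) (T : finType) (f : {poly int})
    (r : T -> L) : Prop :=
  injective r /\ (forall z : L, evalZ f z = 0 <-> exists k, r k = z).

(* Gal(L/Q) as a set of permutations of the labels of the roots. *)
Definition galperm (L : splittingFieldType rat) (T : finType) (r : T -> L)
    : {set {perm T}} :=
  [set s : {perm T} | [exists t in ('Gal({:L} / 1))%g, forall k, t (r k) == r (s k)]]%SET.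

(* A change of L or r replaces [galperm r] by a conjugate in 'S_n. *)
Definition galois_group_is_Sn (n : nat) (g : {poly int}) : Prop :=
  exists (L : splittingFieldType rat) (r : 'I_n -> L),
    [/\ splits_over g L, root_labelling g r & galperm r = [set: 'S_n]%SET].

Definition paired_labelling (L : fieldType) (n : nat) (f : {poly int})
    (r : 'I_n * 'F_2 -> L) : Prop :=
  root_labelling f r /\ forall i, r (i, 0) * r (i, 1) = 1.

(* A change of L or r, where r respects the pairs {a, 1/a}, replaces
   [galperm r] by a conjugate in the wreath product, and all conjugates arise
   in this way: some choice gives a subgroup of G exactly when G_f is conjugate
   to a subgroup of G. *)
Definition galois_group_sub (n : nat) (f : {poly int})
    (G : {set {perm ('I_n * 'F_2)}}) : Prop :=
  exists (L : splittingFieldType rat) (r : 'I_n * 'F_2 -> L),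
    [/\ splits_over f L, paired_labelling f r & galperm r \subset G].

End GaloisGroups.

Section WreathProduct.
Variable n : nat.

Definition wreath_fun (v : 'rV['F_2]_n) (s : 'S_n) (k : 'I_n * 'F_2)
    : 'I_n * 'F_2 := (s k.1, k.2 + v 0 k.1).

Lemma wreath_fun_inj v s : injective (wreath_fun v s).
Proof.
move=> [i a] [j b] e; have /perm_inj ij : s i = s j := congr1 fst e.
have := congr1 snd e; rewrite /wreath_fun /= ij => /(@addIr _ (v 0 j)) -> //.
Qed.

(* The element (v, s) of F_2^n x| S_n, as a permutation of the n pairs; the
   wreath product consists of all of these. *)
Definition wreath_perm v s : {perm ('I_n * 'F_2)} := perm (@wreath_fun_inj v s).

Definition wreath_set : {set {perm ('I_n * 'F_2)}} :=
  [set wreath_perm v s | v in [set: 'rV['F_2]_n], s in [set: 'S_n]]%SET.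

Definition G1_set : {set {perm ('I_n * 'F_2)}} :=
  [set wreath_perm v s | v in [set v : 'rV['F_2]_n | (\sum_i v 0%R i == 0)%R],
                         s in [set: 'S_n]]%SET.

Lemma wreath_permM v s w t :
  (wreath_perm v s * wreath_perm w t)%g =
  wreath_perm (v + \row_i w 0 (s i)) (s * t)%g.
Proof.
by apply/permP => -[i a]; rewrite permM !permE /wreath_fun /= permM !mxE addrA.
Qed.

Lemma wreath_perm1 : wreath_perm 0 1%g = 1%g.
Proof.
by apply/permP => -[i a]; rewrite !permE /wreath_fun /= perm1 mxE addr0.
Qed.

Lemma wreath_group_set : group_set wreath_set.
Proof.
apply/group_setP; split.
  by apply/imset2P; exists 0 1%g; rewrite ?finset.in_setT ?wreath_perm1.
move=> _ _ /imset2P[v s _ _ ->] /imset2P[w t _ _ ->].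
by rewrite wreath_permM; apply/imset2P; eexists; last reflexivity;
  rewrite finset.in_setT.
Qed.

Lemma G1_group_set : group_set G1_set.
Proof.
apply/group_setP; split.
  apply/imset2P; exists 0 1%g; rewrite ?finset.in_setT ?wreath_perm1//.
  by rewrite finset.inE big1// => i _; rewrite mxE.
move=> _ _ /imset2P[v s + _ ->] /imset2P[w t + _ ->].
rewrite !finset.inE => /eqP v0 /eqP w0; rewrite wreath_permM; apply/imset2P.
eexists; last reflexivity; last by rewrite finset.in_setT.
rewrite finset.inE; under eq_bigr do rewrite !mxE.
rewrite big_split/= v0 add0r; apply/eqP; rewrite -[RHS]w0.
by rewrite [RHS](reindex_inj (@perm_inj _ s)).
Qed.

Canonical wreath_group := group wreath_group_set.
Canonical G1 := group G1_group_set.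

Lemma G1_sub_wreath : G1 \subset wreath_group.
Proof.
apply/fintype.subsetP => _ /imset2P[v s _ _ ->].
by apply/imset2P; exists v s; rewrite ?finset.in_setT.
Qed.

End WreathProduct.

Section Counting.
Variable R : realType.

Definition Eset (n : nat) (G : {group {perm ('I_n * 'F_2)}}) (H : R)
    : set {poly int} :=
  [set f : {poly int} | [/\ size f = (2 * n).+1, reciprocal n f, separableZ f,
               forall i, `|(f`_i)%:~R| <= H
             & (exists2 g, trace_poly n f g & galois_group_is_Sn n g) /\
               galois_group_sub f G]].

Definition Eset_monic (n : nat) (G : {group {perm ('I_n * 'F_2)}}) (H : R)
    : set {poly int} :=
  [set f : {poly int} | Eset G H f /\ f \is monic].

Lemma finite_Eset n (G : {group {perm ('I_n * 'F_2)}}) (H : R) :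
  finite_set (Eset G H).
Proof.
pose N := Num.truncn H.
pose F (a : {ffun 'I_(2 * n).+1 -> 'I_(2 * N).+1}) : {poly int} :=
  \poly_(i < (2 * n).+1) ((a (inord i))%:Z - N%:Z).
apply: (@sub_finite_set _ _ (F @` setT)); last exact/finite_image/finite_finset.
move=> f [sf _ _ fH _] /=.
have fN i : `|f`_i| <= N%:Z.
  rewrite -abszE lez_nat truncn_ge_nat; last exact: le_trans (fH 0).
  by apply: le_trans (fH i); rewrite -intr_norm pmulrn abszE.
exists [ffun i : 'I_(2 * n).+1 => inord (absz (f`_i + N%:Z)%R)] => //.
apply/polyP => i; rewrite coef_poly; case: ltnP => [ilt|ige]; last first.
  by rewrite nth_default// sf.
have /andP[fl fu] : (- N%:Z <= f`_i <= N%:Z) by rewrite -ler_norml.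
have f0 : 0 <= f`_i + N%:Z by rewrite -lerBlDr sub0r.
rewrite ffunE !inordK//; first by rewrite gez0_abs// addrK.
by rewrite ltnS -lez_nat gez0_abs// mul2n -addnn PoszD lerD2r.
Qed.

Lemma finite_Eset_monic n (G : {group {perm ('I_n * 'F_2)}}) (H : R) :
  finite_set (Eset_monic G H).
Proof. by apply: sub_finite_set (finite_Eset G H) => f []. Qed.

(* [fset_set] is junk (empty) on infinite sets; the two lemmas above rule that
   out here. *)
Definition E (n : nat) (G : {group {perm ('I_n * 'F_2)}}) (H : R) : nat :=
  #|` fset_set (Eset G H)|%fset.

Definition Emonic (n : nat) (G : {group {perm ('I_n * 'F_2)}}) (H : R) : nat :=
  #|` fset_set (Eset_monic G H)|%fset.

Definition asymp (A B : R -> R) : Prop :=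
  exists c1 c2 : R, [/\ 0 < c1, 0 < c2 &
    exists H0 : R, forall H : R, H0 <= H ->
      c1 * `|B H| <= `|A H| /\ `|A H| <= c2 * `|B H|].

End Counting.

(* Main.v *)
(* The group of f lies in G_1 exactly when prod_i (a_i - 1/a_i) is rational,
   i.e. when (-1)^n f(1) f(-1) = g(2) g(-2) is a square.  A reciprocal f is
   determined by n - 1 of its coefficients together with f(1) and f(-1), and
   |f(1)| = d s^2, |f(-1)| = d t^2 leaves O(sum_d X/d) = O(X log X) pairs with
   X = O(H); this is the upper bound.

   For the lower bound take g = (x^2 - 4) Q + d (u^2 - v^2) x + 2 d (u^2 + v^2),
   so that g(2) = 4 d u^2 and g(-2) = 4 d v^2, with Q, d, u, v in fixed residue
   classes and u, v coprime; coprimality makes the parameters recoverable from f,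
   and a positive proportion of all (u, v) is coprime.  The residue classes are
   chosen modulo three primes such that g is irreducible modulo the first, a
   linear factor times an irreducible one modulo the second, and an irreducible
   quadratic times distinct linear factors modulo the third.  By Dedekind's
   theorem on Frobenius elements the group of g is then transitive, contains an
   (n-1)-cycle and a transposition, hence is S_n. *)
Require Import Defs.
From mathcomp Require Import all_boot all_order all_fingroup all_algebra all_field.
From mathcomp Require Import all_classical all_reals all_analysis.
From HB Require Import structures.
From mathcomp Require Import finmap ring_quotient zify ring lra.
From mathcomp Require cyclic.

Set Implicit Arguments.
Unset Strict Implicit.
Unset Printing Implicit Defensive.

Import Order.TTheory GRing.Theory Num.Theory.
Local Open Scope ring_scope.

(** * Residue fields *)

(** The residue classes are constrained because every member of the family has $g(2)g(-2)$ a square.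
    A factorization modulo $p$ is therefore reachable only if the residue polynomial has square
    product of values at $\pm 2$. Conversely, a monic one with nonzero square product has the shape
    of the family with $u = 1$. Linear factors $x - (w + 1/w)$ satisfy the condition automatically,
    irreducible factors of degree at least 2 after a translation. The primes are large enough for
    the roots $w + 1/w$, with small $w$, to be distinct and different from $\pm 2$.

    The leading coefficient of $g$ may vary, so the roots of $g$ need not be algebraic integers. It
    is kept congruent to 1 modulo the three primes, and the Frobenius element is found by reducing
    multiples of the roots in a residue field of the ring of all algebraic integers.

    The logarithm in the lower bound is again harmonic: for $d$ of size about $j$, both $u$ and $v$
    range up to about $\sqrt{Y/j}$ with $Y \asymp H$, and the $Y/j$ pairs add up to $Y \log Y$. Both
    asymptotics come from one argument, with the number of free coefficients as a parameter. *)

Section ResidueField.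
Variables (A : comNzRingType) (p : A).
Hypothesis p_nunit : forall x : A, x * p != 1.

(** The first clause is conditional so that the empty set qualifies: it is the union of the empty
    chain, which Zorn's lemma also asks about. The nonempty sets of this kind are the proper ideals
    containing [p]. *)
Let ideal_above (X : set A) : Prop :=
  [/\ forall x, X x -> X p, forall a u v, X u -> X v -> X (a * u + v) & ~ X 1].

Let exists_maximal_ideal :
  exists I : set A, ideal_above I /\ forall J, (I `<` J)%classic -> ~ ideal_above J.
Proof.
apply: Zorn_bigcup => F FP totF; split.
- by move=> x [X FX Xx]; exists X => //; case: (FP _ FX) => + _ _; apply; exact: Xx.
- move=> a u v [X FX Xu] [Y FY Yv].
  case: (totF _ _ FX FY) => s; [exists Y|exists X] => //.
  + by case: (FP _ FY) => _ h _; apply: h => //; apply: s.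
  + by case: (FP _ FX) => _ h _; apply: h => //; apply: s.
- by case=> X FX; case: (FP _ FX).
Qed.

Let I : set A := projT1 (cid exists_maximal_ideal).

Let Iid : ideal_above I. Proof. by rewrite /I; case: cid => ? []. Qed.

Let Imax J : (I `<=` J)%classic -> ideal_above J -> J = I.
Proof.
rewrite /I; case: cid => I0 [_ h] /= IJ idJ; apply: contrapT => nJ.
by apply: (h _ _ idJ); split=> // JI; apply: nJ; apply/seteqP.
Qed.

Let Ip : I p.
Proof.
pose J : set A := [set x | exists a, x = a * p]%classic.
have idJ : ideal_above J.
  split; first by move=> x _; exists 1; rewrite mul1r.
    by move=> a _ _ [u ->] [v ->]; exists (a * u + v); ring.
  by case=> a /esym/eqP; apply/negP.
have [[x Ix]|nI] := pselect (exists x, I x).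
  by case: Iid => h _ _; exact: h Ix.
(* Were [I] empty, maximality would still force it to equal the proper ideal generated by [p]. *)
have -> : I = J; last by exists 1; rewrite mul1r.
by apply/esym/Imax => // x Ix; case: nI; exists x.
Qed.

Let I0 : I 0.
Proof. by case: Iid => _ /(_ (-1) p p Ip Ip) h _; move: h; rewrite mulN1r addNr. Qed.

Let Iinv u : ~ I u -> exists r, I (r * u - 1).
Proof.
move=> nIu; case: Iid => _ Icl nI1.
pose J : set A := [set x | exists r a, I a /\ x = a + r * u]%classic.
have [[r [a [Ia e]]]|nJ1] := pselect (J 1).
  exists r; rewrite e opprD addrCA subrr addr0 -[X in I X]addr0 -mulN1r.
  exact: Icl.
have idJ : ideal_above J.
  split=> //; first by move=> *; exists 0, p; rewrite mul0r addr0.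
  move=> c _ _ [r [a [Ia ->]]] [s [b [Ib ->]]]; exists (c * r + s), (c * a + b).
  by split; [exact: Icl | ring].
have IJ : (I `<=` J)%classic by move=> x Ix; exists 0, x; rewrite mul0r addr0.
by case: nIu; rewrite -(Imax IJ idJ); exists 1, 0; rewrite add0r mul1r.
Qed.

Let Ib : {pred A} := fun x => `[< I x >].

Let Ib_closed : idealr_closed Ib.
Proof.
case: Iid => _ Icl nI1; split; first exact/asboolP.
  by apply/asboolP.
by move=> a u v /asboolP Iu /asboolP Iv; apply/asboolP/Icl.
Qed.

Lemma residue_field : exists (K : fieldType) (phi : {rmorphism A -> K}), phi p = 0.
Proof.
pose Iid_ := isIdealr.Build A Ib Ib_closed.
pose idI : idealr A := HB.pack Ib Iid_.
pose Q : comNzRingType := {ideal_quot idI}.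
pose pi : {rmorphism A -> Q} := \pi_{ideal_quot idI}%qT.
have pi0 x : (pi x == 0) = (x \in Ib).
  have := Quotient.idealrBE idI x 0; rewrite subr0 => ->.
  by rewrite [RHS]/eq_op /= -(rmorph0 pi).
have inv_ex (y : Q) : exists z, y != 0 -> z * y = 1.
  have [->|y0] := eqVneq y 0; first by exists 0.
  have [x ex] : exists x, pi x = y.
    by exists (generic_quotient.repr y); exact: generic_quotient.reprK.
  have nx : ~ I x.
    by move=> Ix; move/eqP: y0; apply; apply/eqP; rewrite -ex pi0; apply/asboolP.
  have [r /asboolP Ir] := Iinv nx.
  exists (pi r) => _; apply/eqP; rewrite -subr_eq0 -ex.
  by rewrite -rmorphM -(rmorph1 pi) -rmorphB pi0.
pose inv y := if y == 0 then 0 else projT1 (cid (inv_ex y)).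
have mulV (x : Q) : x != 0 -> inv x * x = 1.
  by move=> x0; rewrite /inv ifN//; case: cid => z /=; apply.
have inv0 : inv 0 = 0 by rewrite /inv ifT.
pose QF := GRing.ComNzRing_isField.Build Q mulV inv0.
pose K : fieldType := HB.pack (GRing.ComNzRing.sort Q) QF.
by exists K, pi; apply/eqP; rewrite pi0; apply/asboolP.
Qed.

End ResidueField.

(** * Galois groups as permutation groups of the roots *)

Lemma map_poly_rmorph_intr (R S : nzRingType) (phi : {rmorphism R -> S})
    (f : {poly int}) :
  map_poly phi (map_poly intr f) = map_poly intr f.
Proof. by apply/polyP => i; rewrite !coef_map /= rmorph_int. Qed.

Lemma gal_rat_fixed (L : splittingFieldType rat) (x : L) :
  (forall t, t \in 'Gal({:L} / 1)%g -> t x = x) -> exists q : rat, x = ratr q.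
Proof.
move=> xfix.
have /galois_fixedField fE : galois 1 {:L}.
  apply/and3P; split; [exact: sub1v | | exact: normalFieldf].
  by apply/separableP => y _; apply: pcharf0_separable => l; rewrite pchar_lalg pchar_num.
have : x \in fixedField 'Gal({:L} / 1)%g by apply/fixedFieldP; rewrite ?memvf.
by rewrite fE => /vlineP[q ->]; exists q; rewrite alg_num_field.
Qed.

Lemma galperm_lift (L : splittingFieldType rat) (T : finType) (f : {poly int})
    (r : T -> L) (t : gal_of {:L}) :
  root_labelling f r -> t \in 'Gal({:L} / 1)%g ->
  exists2 s, s \in galperm r & forall k, t (r k) = r (s k).
Proof.
move=> [rI rE] tG.
have tr k : exists j, r j = t (r k).
  have /rE[j <-] : evalZ f (t (r k)) = 0; last by exists j.
  have /rE h : exists j, r j = r k by exists k.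
  rewrite /evalZ; have -> : map_poly intr f = map_poly t (map_poly intr f) :> {poly L}.
    by rewrite map_poly_rmorph_intr.
  by rewrite horner_map -/(evalZ f (r k)) h rmorph0.
have [s0 s0E] := choice tr.
have s0I : injective s0.
  by move=> i j e; have := s0E i; rewrite e s0E => /fmorph_inj/rI.
exists (perm s0I) => [|k]; last by rewrite permE s0E.
rewrite finset.inE; apply/existsP; exists t; rewrite tG/=.
by apply/forallP => k; rewrite permE s0E.
Qed.

Lemma galpermP (L : splittingFieldType rat) (T : finType) (r : T -> L) (s : {perm T}) :
  reflect (exists2 t, t \in 'Gal({:L} / 1)%g & forall k, t (r k) = r (s k))
          (s \in galperm r).
Proof.
rewrite finset.inE; apply: (iffP existsP) => [[t /andP[tG /forallP h]]|[t tG h]].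
  by exists t => // k; apply/eqP.
by exists t; rewrite tG; apply/forallP => k; rewrite h.
Qed.

Lemma galperm_group_set (L : splittingFieldType rat) (T : finType)
  (r : T -> L) : injective r -> group_set (galperm r).
Proof.
move=> rI; apply/group_setP; split.
  by apply/galpermP; exists 1%g; [exact: group1 | move=> k; rewrite gal_id perm1].
move=> s u /galpermP[a aG ha] /galpermP[b bG hb]; apply/galpermP; exists (a * b)%g.
  exact: groupM.
by move=> k; rewrite galM ?memvf// ha hb permM.
Qed.

Section SplittingFieldInC.
Variables (T : finType) (f : {poly int}) (a : int) (z : T -> algC).
Hypotheses (a0 : a != 0) (zI : injective z).
Hypothesis fE : map_poly intr f = a%:~R *: \prod_k ('X - (z k)%:P) :> {poly algC}.

(** The field is the number field generated by the [z k], so it splits [f] by construction. The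
    embedding [iota] is kept because integrality of the roots is tested in [algC], while the Galois
    group is that of [L]. *)
Lemma splitting_field_in_C :
  exists (L : splittingFieldType rat) (iota : {rmorphism L -> algC}) (r : T -> L),
  [/\ Defs.splits_over f L, root_labelling f r,
      map_poly intr f = a%:~R *: \prod_k ('X - (r k)%:P) :> {poly L}
    & forall k, iota (r k) = z k].
Proof.
have [Q [QC [s sE sgen]]] := num_field_exists (codom z).
have r_ex k : exists x, x \in s /\ QC x = z k.
  have : z k \in map QC s by rewrite sE codom_f.
  by case/mapP => x xs ->; exists x.
have [r rE] := choice r_ex.
have rI : injective r by move=> i j e; apply: zI; rewrite -(rE i).2 -(rE j).2 e.
have fEQ : map_poly intr f = a%:~R *: \prod_k ('X - (r k)%:P) :> {poly Q}.
  apply: (map_poly_inj QC); rewrite map_poly_rmorph_intr.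
  rewrite fE map_polyZ rmorph_int; congr (_ *: _); rewrite rmorph_prod /=.
  by apply: eq_bigr => k _; rewrite map_polyXsubC (rE k).2.
have aQ : a%:~R != 0 :> Q by rewrite -(fmorph_eq0 QC) rmorph_int intr_eq0.
have spl : splittingFieldFor 1%VS (map_poly intr f : {poly Q}) {:Q}%VS.
  exists (codom r).
    by rewrite fEQ big_image /= eqp_scale.
  apply/eqP; rewrite eqEsubv subvf -sgen adjoin_seqSr//.
  move=> x xs; have : QC x \in codom z by rewrite -sE map_f.
  case/codomP => k e; apply/codomP; exists k; apply: (fmorph_inj QC).
  by rewrite (rE k).2.
have Q_ax : FieldExt_isSplittingField _ Q.
  constructor; exists (map_poly intr f) => //.
  by apply/polyOverP => i; rewrite coef_map rpred_int.
pose L : splittingFieldType rat := HB.pack_for (splittingFieldType rat) Q Q_ax.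
exists L, QC, r; split=> //; last by move=> k; rewrite (rE k).2.
split=> // x; rewrite /evalZ fEQ hornerZ horner_prod; split.
  move/eqP; rewrite mulf_eq0 (negPf aQ) /= => /prodf_eq0[k _].
  by rewrite hornerXsubC subr_eq0 => /eqP ->; exists k.
case=> k <-; apply/eqP; rewrite mulf_eq0; apply/orP; right.
by apply/prodf_eq0; exists k; rewrite ?hornerXsubC ?subrr.
Qed.

End SplittingFieldInC.

(** * Frobenius elements *)

(** All algebraic integers at once. Galois invariance is established in [L] and transported by
    [iota], so this ring itself carries no Galois action. *)
Definition algInt := {x : algC | x \in Aint}.
HB.instance Definition _ := SubChoice.on algInt.
HB.instance Definition _ := [SubChoice_isSubComNzRing of algInt by <:].

(** An inverse of [p] would be a rational algebraic integer, hence an integer. This makes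
    [residue_field] applicable to [algInt]. *)
Lemma nat_nunit_algInt (p : nat) (x : algInt) : (1 < p)%N -> x * p%:R != 1.
Proof.
move=> p1; apply/eqP => e.
have p0 : p%:R != 0 :> algC by rewrite pnatr_eq0; lia.
have vE : val x = p%:R^-1.
  have := congr1 val e; rewrite rmorphM rmorph_nat rmorph1 => h.
  by apply: (mulIf p0); rewrite h mulVf.
have : val x \in Num.int.
  by apply: Cint_rat_Aint (valP x); rewrite vE rpredV rpred_nat.
case/intrP => m mE; have : (m * p%:Z)%:~R = 1 :> algC.
  by rewrite intrM -mE vE -pmulrn mulVf.
move/eqP; rewrite -[1]/(1%:~R) eqr_int => /eqP mp.
have : (p%:Z %| 1)%Z by apply/dvdzP; exists m.
by rewrite dvdz1; lia.
Qed.

Lemma factored_size_lead (T : finType) (f : {poly int}) (a : int) (z : T -> algC) :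
  a != 0 -> map_poly intr f = a%:~R *: \prod_k ('X - (z k)%:P) :> {poly algC} ->
  size f = #|T|.+1 /\ lead_coef f = a.
Proof.
move=> a0 fE; have aC : a%:~R != 0 :> algC by rewrite intr_eq0.
have m : (\prod_k ('X - (z k)%:P)) \is monic by exact: monic_prod_XsubC.
split.
  have := congr1 (fun q : {poly algC} => size q) fE.
  rewrite size_map_inj_poly ?rmorph0//; last exact: intr_inj.
  by rewrite size_scale// size_prod_XsubC /index_enum -enumT -cardE => ->.
have := congr1 (fun q : {poly algC} => lead_coef q) fE.
rewrite lead_coef_map_inj ?rmorph0//; last exact: intr_inj.
by rewrite lead_coefZ (monicP m) mulr1 => /intr_inj.
Qed.

Lemma coef_sumZXn (R : nzRingType) (n : nat) (c : 'I_n -> R) (j : 'I_n) :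
  (\sum_k c k *: 'X^k)`_j = c j.
Proof.
rewrite coef_sum (bigD1 j)//= coefZ coefXn eqxx mulr1 big1 ?addr0// => k kj.
by rewrite coefZ coefXn (inj_eq val_inj) eq_sym (negPf kj) mulr0.
Qed.

Lemma map_scaleX_subC (R S : nzRingType) (phi : {rmorphism R -> S}) (c b : R) :
  map_poly phi (c *: 'X - b%:P) = phi c *: 'X - (phi b)%:P.
Proof.
apply/polyP => i; rewrite coef_map !(coefB, coefZ, coefX, coefC) /= rmorphB.
by rewrite rmorphM rmorph_nat; case: ifP => //; rewrite rmorph0.
Qed.

Lemma map_poly_sumZXn (R S : nzRingType) (phi : {rmorphism R -> S}) (n : nat)
    (c : 'I_n -> R) :
  map_poly phi (\sum_k c k *: 'X^k) = \sum_k phi (c k) *: 'X^k.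
Proof.
rewrite rmorph_sum /=; apply: eq_bigr => k _.
by apply/polyP => i; rewrite coef_map !(coefZ, coefXn) /= rmorphM rmorph_nat.
Qed.

Section Frobenius.
Variables (n : nat) (L : splittingFieldType rat) (iota : {rmorphism L -> algC}).
Variables (f : {poly int}) (a : int) (r : 'I_n -> L).
Hypothesis a0 : a != 0.
Hypothesis rf : root_labelling f r.
Hypothesis fE : map_poly intr f = a%:~R *: \prod_k ('X - (r k)%:P) :> {poly L}.

Let iota_factored :
  map_poly intr f = a%:~R *: \prod_k ('X - (iota (r k))%:P) :> {poly algC}.
Proof.
rewrite -(map_poly_rmorph_intr iota) fE map_polyZ rmorph_int; congr (_ *: _).
by rewrite rmorph_prod /=; apply: eq_bigr => j _; rewrite map_polyXsubC.
Qed.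

Lemma Aint_scaled_root k : iota (a%:~R * r k) \in Aint.
Proof.
have n0 : (0 < n)%N by case: k => m; lia.
have [szf lf'] := factored_size_lead a0 iota_factored; rewrite card_ord in szf.
have lf : f`_n = a by rewrite -lf' lead_coefE szf.
(* This is $a^{n-1} f(X/a)$, which is monic and vanishes at $a$ times each root. The top coefficient
   is set apart because the truncated exponent [n.-1 - n] is 0 instead of -1. *)
pose F : {poly algC} := \poly_(i < n.+1) (if i == n then 1 else (f`_i * a ^+ (n.-1 - i))%:~R).
have Fn : F`_n = 1 by rewrite coef_poly ltnSn eqxx.
have szF : size F = n.+1 by rewrite size_poly_eq//= eqxx oner_eq0.
apply: (@root_monic_Aint F).
- rewrite /root; set y := iota _.
  have f0 : (map_poly intr f).[iota (r k)] = 0 :> algC.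
    rewrite iota_factored hornerZ horner_prod (bigD1 k)//= hornerXsubC subrr mul0r mulr0.
    by [].
  have yE : y = a%:~R * iota (r k) by rewrite /y rmorphM rmorph_int.
  apply/eqP; rewrite -[RHS](mulr0 (a%:~R ^+ n.-1)) -f0 horner_poly.
  rewrite horner_coef size_map_inj_poly ?rmorph0//; last exact: intr_inj.
  rewrite szf mulr_sumr; apply: eq_bigr => i _; rewrite coef_map /=.
  have : (i <= n)%N by rewrite -ltnS.
  rewrite yE exprMn; case: eqVneq => [->|ni] ilt.
    rewrite lf mul1r mulrA -exprSr prednK//.
  have e : n.-1 = (n.-1 - i + i)%N by lia.
  rewrite [in RHS]e exprD intrM rmorphXn /=.
  by ring.
- by apply/monicP; rewrite lead_coefE szF.
- apply/polyOverP => i; rewrite coef_poly.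
  by case: ifP => _; [case: ifP => _; rewrite ?rpred1 ?rpred_int | rewrite rpred0].
Qed.

(* The coefficients of [prod_t (X - sum_k (t b_k) T^k)], with [t] in the Galois
   group and [b_k = a r_k], are integers, so its reduction in [K[T][X]] is fixed
   by the Frobenius of [K]; hence [sum_k beta_k^p T^k] is a root of it along with
   [sum_k beta_k T^k]. *)
Theorem frobenius_lift (p : nat) : prime p -> (p %| a - 1)%Z ->
  exists (K : fieldType) (beta : 'I_n -> K),
  [/\ p \in [pchar K], map_poly intr f = \prod_k ('X - (beta k)%:P) :> {poly K}
    & exists2 s, s \in galperm r & forall k, beta (s k) = beta k ^+ p].
Proof.
move=> p_pr pa.
have nunit : forall x : algInt, x * p%:R != 1.
  by move=> x; apply: nat_nunit_algInt; exact: prime_gt1.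
have [K [phi phip]] := residue_field nunit.
have chK : p \in [pchar K] by rewrite inE p_pr /= -(rmorph_nat phi) phip.
have aK : a%:~R = 1 :> K.
  apply/eqP; rewrite -subr_eq0 -[1]/(1%:~R) -intrB.
  case/dvdzP: pa => m ->; rewrite intrM -pmulrn.
  by move: chK; rewrite inE => /andP[_ /eqP ->]; rewrite mulr0.
pose b k : algInt := Sub (iota (a%:~R * r k)) (Aint_scaled_root k).
pose beta k := phi (b k).
pose vA : {rmorphism algInt -> algC} := (val : algInt -> algC).
have bE k : vA (b k) = iota (a%:~R * r k) by [].
exists K, beta; split=> //.
  (* Only the multiples [b k] lie in [algInt], so the factorization of [f] is written there after
     scaling by powers of [a]; these become 1 in [K]. *)
  have eA : a%:~R *: \prod_k (a%:~R *: 'X - (b k)%:P) =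
      a%:~R ^+ n *: map_poly intr f :> {poly algInt}.
    apply: (@map_inj_poly _ _ vA); [exact: val_inj|exact: rmorph0|].
    rewrite !map_polyZ rmorphXn rmorph_prod map_poly_rmorph_intr.
    rewrite (eq_bigr (fun k => a%:~R *: ('X - (iota (r k))%:P))); last first.
      move=> k _; rewrite [LHS]map_scaleX_subC rmorph_int.
      by rewrite bE scalerBr rmorphM rmorph_int polyCM mul_polyC.
    by rewrite scaler_prod prodr_const card_ord rmorph_int iota_factored !scalerA mulrC.
  have := congr1 (map_poly phi) eA; rewrite !map_polyZ rmorphXn /= !rmorph_int aK.
  rewrite expr1n !scale1r rmorph_prod map_poly_rmorph_intr.
  move=> <-; apply: eq_bigr => k _.
  by rewrite [LHS]map_scaleX_subC rmorph_int aK scale1r.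
have sg_ex (t : gal_of {:L}) : exists s : 'S_n, t \in 'Gal({:L} / 1)%g ->
    s \in galperm r /\ forall k, t (r k) = r (s k).
  have [tG|] := boolP (t \in 'Gal({:L} / 1)%g); last by exists 1%g.
  by have [s sr sE] := galperm_lift rf tG; exists s.
have [sg sgE] := choice sg_ex.
pose theta : {poly L} := \sum_k (a%:~R * r k) *: 'X^k.
pose thA (s : 'S_n) : {poly algInt} := \sum_k b (s k) *: 'X^k.
pose NA : {poly {poly algInt}} := \prod_(t in 'Gal({:L} / 1)%g) ('X - (thA (sg t))%:P).
pose NL : {poly {poly L}} :=
  \prod_(t in 'Gal({:L} / 1)%g) ('X - (map_poly (t : gal_of {:L}) theta)%:P).
have NE : map_poly (map_poly vA) NA = map_poly (map_poly iota) NL.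
  rewrite !rmorph_prod; apply: eq_bigr => t tG; rewrite [LHS]map_polyXsubC [RHS]map_polyXsubC.
  congr (_ - polyC _); rewrite [LHS]map_poly_sumZXn -[RHS]/(map_poly iota (map_poly t theta)).
  rewrite /theta !map_poly_sumZXn; apply: eq_bigr => k _; congr (_ *: _).
  by rewrite bE -((sgE t tG).2 k) !rmorphM !rmorph_int.
have NLfix u : u \in 'Gal({:L} / 1)%g -> map_poly (map_poly u) NL = NL.
  move=> uG; rewrite rmorph_prod /= [RHS](reindex_inj (mulIg u)).
  apply: eq_big => [t|t tG]; first by rewrite groupMr.
  rewrite [LHS]map_polyXsubC; congr (_ - polyC _).
  rewrite -[LHS]/(map_poly u (map_poly t theta)) /theta !map_poly_sumZXn.
  by apply: eq_bigr => k _ /=; rewrite galM ?memvf.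
have NAint i j : exists m : int, NA`_i`_j = m%:~R.
  have [q qE] : exists q : rat, NL`_i`_j = ratr q.
    apply: gal_rat_fixed => t tG.
    by rewrite -[in RHS](NLfix t tG) !coef_map.
  have vE : vA (NA`_i`_j) = ratr q.
    have := congr1 (fun h : {poly {poly algC}} => h`_i`_j) NE.
    by rewrite !coef_map /= qE fmorph_rat.
  have : vA (NA`_i`_j) \in Num.int.
    by apply: Cint_rat_Aint (valP NA`_i`_j); rewrite vE; apply/CratP; exists q.
  by case/intrP => m mE; exists m; apply: val_inj; rewrite -[LHS]/(vA _) mE -[RHS]/(vA _) rmorph_int.
pose Fr : {rmorphism K -> K} := pFrobenius_aut chK.
pose NK : {poly {poly K}} := map_poly (map_poly phi) NA.
have NKfix : map_poly (map_poly Fr) NK = NK.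
  apply/polyP => i; apply/polyP => j; rewrite !coef_map /=.
  by have [m ->] := NAint i j; rewrite !rmorph_int.
pose th1 : {poly K} := \sum_k beta k *: 'X^k.
have thE s : map_poly phi (thA s) = \sum_k beta (s k) *: 'X^k.
  by rewrite map_poly_sumZXn.
have NKE : NK = \prod_(t in 'Gal({:L} / 1)%g) ('X - (\sum_k beta (sg t k) *: 'X^k)%:P).
  by rewrite /NK rmorph_prod /=; apply: eq_bigr => t _; rewrite map_polyXsubC /= thE.
have N1 : NK.[th1] = 0.
  rewrite NKE horner_prod (bigD1 1%g) ?group1//= hornerXsubC.
  rewrite (_ : \sum_k _ = th1) ?subrr ?mul0r//; apply: eq_bigr => k _.
  congr (beta _ *: _); apply/rf.1.
  by rewrite -(sgE 1%g (group1 _)).2 gal_id.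
have : NK.[map_poly Fr th1] = 0 by rewrite -NKfix horner_map /= N1 rmorph0.
(* One factor vanishes, as [{poly K}] is a domain. Comparing coefficients in the auxiliary variable
   then gives the same [t] for all [k] at once. *)
rewrite NKE horner_prod => /eqP/prodf_eq0[t tG].
rewrite hornerXsubC subr_eq0 => /eqP e.
exists (sg t) => [|k]; first exact: (sgE t tG).1.
have := congr1 (fun h : {poly K} => h`_k) e.
by rewrite coef_map !coef_sumZXn /= pFrobenius_autE.
Qed.

End Frobenius.

(** $X^p - X$ is the product of the $X - c$ over $c \in \mathbb{F}_p$, so it has no further roots in
    [K]. Data fixed by Frobenius thereby descend to $\mathbb{F}_p$. *)
Lemma Fp_embedding (p : nat) (K : fieldType) : p \in [pchar K] ->
  exists j : {rmorphism 'F_p -> K}, forall x : K, x ^+ p = x -> exists c, x = j c.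
Proof.
move=> chK; have p_pr := pcharf_prime chK.
pose j : {rmorphism 'F_p -> K} :=
  (in_alg (pPrimeCharType chK) : {rmorphism 'F_p -> pPrimeCharType chK}).
exists j => x xp.
have := congr1 (fun q => (map_poly j q).[x]) (finField_genPoly 'F_p).
have -> : map_poly j ('X^#|'F_p| - 'X) = 'X^p - 'X.
  by rewrite card_Fp// rmorphB; congr (_ - _); [exact: map_polyXn | exact: map_polyX].
rewrite !hornerE xp subrr.
rewrite rmorph_prod horner_prod => /esym/eqP/prodf_eq0[c _].
rewrite (_ : _.[x] = ('X - (j c)%:P).[x]); last by congr _.[x]; exact: map_polyXsubC.
by rewrite hornerXsubC subr_eq0 => /eqP; exists c.
Qed.

Section FrobeniusCycles.
Variables (p n : nat) (K : fieldType) (f : {poly 'F_p}) (j : {rmorphism 'F_p -> K}).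
Variables (beta : 'I_n -> K) (s : 'S_n).
Hypothesis chK : p \in [pchar K].
Hypothesis jP : forall x : K, x ^+ p = x -> exists c, x = j c.
Hypothesis fE : map_poly j f = \prod_k ('X - (beta k)%:P).
Hypothesis sE : forall k, beta (s k) = beta k ^+ p.

Let p_pr : prime p. Proof. exact: pcharf_prime chK. Qed.

Let jX c : j c ^+ p = j c.
Proof. rewrite -rmorphXn; congr (j _); rewrite -[RHS]expf_card; congr (_ ^+ _).
by rewrite card_Fp. Qed.

(** Frobenius permutes the factors of the product in the same way as [s], so it fixes every
    coefficient, and these lie in $\mathbb{F}_p$. *)
Lemma frobenius_stable_factor (S : {set 'I_n}) : (forall k, (s k \in S) = (k \in S)) ->
  exists h : {poly 'F_p}, map_poly j h = \prod_(k in S) ('X - (beta k)%:P).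
Proof.
move=> sS; set q := \prod_(k in S) _.
have [h hE] : {h : nat -> 'F_p & forall i, q`_i = j (h i)}.
  suff ex i : exists c, q`_i = j c by have /boolp.choice[h hE] := ex; exists h.
  apply: jP.
  pose Fr : {rmorphism K -> K} := pFrobenius_aut chK.
  suff : map_poly Fr q = q.
    by move=> /(congr1 (fun u : {poly K} => u`_i)); rewrite coef_map /= pFrobenius_autE.
  rewrite /q rmorph_prod [RHS](reindex_inj (@perm_inj _ s)).
  apply: eq_big => [k|k _]; first by rewrite sS.
  by rewrite [LHS]map_polyXsubC sE /= pFrobenius_autE.
exists (\poly_(i < size q) h i); apply/polyP => i; rewrite coef_map coef_poly.
case: ltnP => [_|ge]; first by rewrite hE.
by rewrite nth_default//; exact: rmorph0.
Qed.

Let porbit_stable i k : (s k \in porbit s i) = (k \in porbit s i).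
Proof.
by rewrite -!eq_porbit_mem -[s k]/((s ^+ 1)%g k) porbit_perm.
Qed.

Let size_prodS (S : {set 'I_n}) : size (\prod_(k in S) ('X - (beta k)%:P)) = #|S|.+1.
Proof. by rewrite -big_enum /= size_prod_XsubC -cardE. Qed.

(** The orbit yields a nonconstant factor of [h] over $\mathbb{F}_p$, which by irreducibility has
    full degree. *)
Let irreducible_orbit (h : {poly 'F_p}) (A : {set 'I_n}) (i : 'I_n) :
  irreducible_poly h -> map_poly j h = \prod_(k in A) ('X - (beta k)%:P) ->
  porbit s i \subset A -> porbit s i = A.
Proof.
move=> [_ hirr] hE iA; have [q qE] := frobenius_stable_factor (porbit_stable i).
have qh : q %| h.
  rewrite -(dvdp_map j) qE hE [X in _ %| X](bigID (mem (porbit s i))) /=.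
  rewrite (eq_bigl (fun k => (k \in A) && (k \in porbit s i))) ?dvdp_mulr// => k.
  by rewrite andb_idl// => /(fintype.subsetP iA).
have szq : size q = #|porbit s i|.+1 by rewrite -(size_map_poly j) qE size_prodS.
have /hirr/(_ qh)/eqp_size : size q != 1.
  by rewrite szq eqSS -lt0n card_gt0; apply/set0Pn; exists i; exact: porbit_id.
rewrite szq -(size_map_poly j h) hE size_prodS => -[e].
by apply/eqP; rewrite finset.eqEcard iA e /=.
Qed.

Lemma frobenius_irreducible : irreducible_poly f -> forall i, porbit s i = [set: 'I_n]%SET.
Proof.
move=> firr i; apply: (irreducible_orbit firr); last exact: finset.subsetT.
by rewrite fE; apply: eq_bigl => k; rewrite finset.in_setT.
Qed.

Lemma frobenius_linear_irreducible (c : 'F_p) (h : {poly 'F_p}) :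
  f = ('X - c%:P) * h -> irreducible_poly h -> ~~ root h c ->
  exists i0, s i0 = i0 /\ forall i, i != i0 -> porbit s i = [set~ i0]%SET.
Proof.
move=> fh hirr hc.
have mf : map_poly j f = ('X - (j c)%:P) * map_poly j h.
  by rewrite fh rmorphM /= map_polyXsubC.
have : (map_poly j f).[j c] = 0 by rewrite mf hornerM hornerXsubC subrr mul0r.
rewrite fE horner_prod => /eqP/prodf_eq0[i0 _].
rewrite hornerXsubC subr_eq0 => /eqP ji0.
have hE : map_poly j h = \prod_(k in [set~ i0]%SET) ('X - (beta k)%:P).
  have nz : 'X - (j c)%:P != 0 by rewrite polyXsubC_eq0.
  apply: (mulfI nz); rewrite -mf fE (bigD1 i0)//= ji0; congr (_ * _).
  by apply: eq_bigl => k; rewrite !finset.inE.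
(* Otherwise [s i0] would index a root of [h], and its value is the Frobenius image of [j c], that
   is [j c] itself. *)
have si0 : s i0 = i0.
  apply: contraNeq hc => ne; rewrite -(fmorph_root j) /root hE horner_prod.
  apply/prodf_eq0; exists (s i0); first by rewrite !finset.inE.
  by rewrite hornerXsubC sE -ji0 jX subrr.
exists i0; split=> // i ii0; apply: (irreducible_orbit hirr hE).
apply/fintype.subsetP => k; rewrite !finset.inE; apply: contraTneq => ->.
rewrite porbit_sym; apply/negP => /porbitP[m mE].
have : i = i0 by rewrite mE permX; elim: m {mE} => //= m ->.
by move/eqP; apply/negP.
Qed.

(** Both roots of [q] lie outside $\mathbb{F}_p$ and are moved by Frobenius, while the other roots
    are fixed. Hence [s] moves exactly two indices. *)
Lemma frobenius_quadratic (q : {poly 'F_p}) (cs : seq 'F_p) :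
  f = q * \prod_(c <- cs) ('X - c%:P) -> irreducible_poly q -> size q = 3 ->
  uniq cs -> exists x y, x != y /\ s = tperm x y.
Proof.
move=> fq qirr szq csU.
have qnr c : ~~ root q c.
  apply/negP; rewrite root_factor_theorem => /(qirr.2 _); rewrite size_XsubC => /(_ isT).
  by move/eqp_size; rewrite size_XsubC szq.
have mf : map_poly j f = map_poly j q * \prod_(x <- map j cs) ('X - x%:P).
  rewrite fq rmorphM rmorph_prod big_map; congr (_ * _); apply: eq_bigr => c _.
  exact: map_polyXsubC.
have prodE : \prod_k ('X - (beta k)%:P) = \prod_(x <- codom beta) ('X - x%:P).
  by rewrite big_image.
have [rs qrs] : exists rs, map_poly j q %= \prod_(x <- rs) ('X - x%:P).
  have : map_poly j q %| \prod_(x <- codom beta) ('X - x%:P).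
    by rewrite -prodE -fE mf dvdp_mulr.
  by case/(dvdp_prod_XsubC (F := id)) => m; exists (mask m (codom beta)).
have szrs : size rs = 2.
  by move/eqp_size: qrs; rewrite size_map_poly szq size_prod_XsubC => -[].
have pe : perm_eq (codom beta) (rs ++ map j cs).
  apply: prod_XsubC_eq; rewrite big_cat /=; apply/eqP.
  rewrite -eqp_monic ?rpredM ?monic_prod_XsubC//.
  by rewrite -prodE -fE mf eqp_mulr.
have rsn x : x \in rs -> x ^+ p != x.
  move=> xrs; apply/eqP => /jP[c xc]; move/negP: (qnr c); apply.
  by rewrite -(fmorph_root j) (eqp_root qrs) root_prod_XsubC -xc.
pose F : {set 'I_n} := [set k | beta k ^+ p == beta k]%SET.
have cardF : #|~: F| = 2.
  have -> : #|~: F| = count (fun x : K => x ^+ p != x) (codom beta).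
    rewrite /codom /image_mem count_map enumT cardE /enum_mem size_filter.
    by apply: eq_count => k /=; rewrite !finset.inE.
  rewrite (seq.permP pe) count_cat -szrs -[RHS]addn0; congr (_ + _)%N.
    by apply/eqP; rewrite -all_count; apply/allP => x /rsn.
  rewrite count_map; apply/eqP; rewrite -leqn0 leqNgt -has_count; apply/hasPn => c _ /=.
  by rewrite jX eqxx.
(* [beta] is not assumed injective. A value fixed by Frobenius nevertheless occurs only once among
   the roots: [cs] has no repetitions and the roots of [q] are not fixed. So equal values at [k] and
   [s k] give equal indices. *)
have sF k : (s k == k) = (k \in F).
  rewrite finset.inE -sE; apply/eqP/eqP => [-> //|e].
  have bk : beta k \in map j cs.
    have : beta k \in rs ++ map j cs by rewrite -(perm_mem pe) codom_f.
    rewrite mem_cat => /orP[/rsn|//]; by rewrite -sE e eqxx.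
  apply: contraTeq isT => ne.
  have : (count_mem (beta k) (codom beta) <= 1)%N.
    rewrite (seq.permP pe) count_cat (count_memPn _) ?count_uniq_mem ?leq_b1//.
      by rewrite (map_inj_uniq (fmorph_inj j)).
    by apply/negP => /rsn; rewrite -sE e eqxx.
  rewrite /codom /image_mem count_map -size_filter leqNgt; case/negP.
  apply: (@uniq_leq_size _ [:: s k; k]).
    by rewrite /= inE ne.
  by move=> x; rewrite !inE mem_filter mem_enum /= => /orP[] /eqP ->; rewrite ?e eqxx.
have /eqP/cards2P[x [y [xy FE]]] := cardF.
have inF k : (k \in F) = (k \notin [set x; y]%SET) by rewrite -FE finset.in_setC negbK.
have mv k : k \in [set x; y]%SET -> s k \in [set x; y]%SET.
  apply: contraLR; rewrite -!inF -!sF => /eqP/perm_inj => ->.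
  by rewrite eqxx.
have sx : s x = y.
  have /mv := finset.set21 x y; rewrite !finset.inE => /orP[/eqP e|/eqP//].
  by have := inF x; rewrite -sF e eqxx finset.set21.
have sy : s y = x.
  have /mv := finset.set22 x y; rewrite !finset.inE => /orP[/eqP //|/eqP e].
  by have := inF y; rewrite -sF e eqxx finset.set22.
exists x, y; split=> //; apply/permP => k; case: tpermP => [->|->|/eqP kx /eqP ky] //.
by apply/eqP; rewrite sF inF !finset.inE negb_or kx ky.
Qed.

End FrobeniusCycles.

(** * Generating the symmetric group *)

Section SymmetricGroupGeneration.
Variables (n : nat) (G : {group 'S_n}) (c a : 'S_n) (i0 x0 y0 : 'I_n).
Hypotheses (cG : c \in G) (aG : a \in G) (tG : tperm x0 y0 \in G) (xy0 : x0 != y0).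
Hypothesis c_cycle : forall i, porbit c i = [set: 'I_n]%SET.
Hypothesis a_cycle : forall i, i != i0 -> porbit a i = [set~ i0]%SET.
Hypothesis a_fix : a i0 = i0.

(** Conjugating the given transposition by a power of [c] produces one that moves [i0]; powers of
    [a] then give every [tperm i0 w], and conjugating these by one another gives every
    transposition. *)
Lemma generate_Sn : G = [set: 'S_n]%SET :> {set 'S_n}.
Proof.
have tJ u v g : g \in G -> tperm u v \in G -> tperm (g u) (g v) \in G.
  by move=> gG uvG; rewrite -tpermJ memJ_norm// (fintype.subsetP (normG G)).
have [g gG gx] : exists2 g, g \in G & g x0 = i0.
  have : i0 \in porbit c x0 by rewrite c_cycle finset.in_setT.
  by case/porbitP => m ->; exists (c ^+ m)%g => //; rewrite groupX.
set z := g y0.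
have zi0 : z != i0 by rewrite -gx (inj_eq perm_inj) eq_sym.
have zG : tperm i0 z \in G by rewrite -gx; apply: tJ.
have ti0 w : tperm i0 w \in G.
  have [->|wi0] := eqVneq w i0; first by rewrite tperm1 group1.
  have : w \in porbit a z by rewrite a_cycle// !finset.inE.
  case/porbitP => m ->.
  rewrite -[X in tperm X _](_ : (a ^+ m)%g i0 = i0); first by rewrite tJ ?groupX.
  by rewrite permX; elim: m => //= m ->.
have tuv u v : tperm u v \in G.
  have [->|uv] := eqVneq u v; first by rewrite tperm1 group1.
  have [->|vi0] := eqVneq v i0; first by rewrite tpermC.
  have [->//|ui0] := eqVneq u i0.
  have := tJ i0 u _ (ti0 v) (ti0 u); rewrite tpermL tpermD 1?eq_sym//.
  by rewrite tpermC.
apply/eqP; rewrite finset.eqEsubset finset.subsetT /=; apply/fintype.subsetP => s _.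
have [ts -> _] := prod_tpermP s; exact: group_prod.
Qed.

End SymmetricGroupGeneration.

(** * From factorizations modulo primes to the Galois group over the rationals *)

Lemma intr_Fp_eq0 (p : nat) (c : int) : prime p ->
  (c%:~R == 0 :> 'F_p) = (p %| c)%Z.
Proof.
move=> p_pr; rewrite [c]intEsign rmorphMsign mulf_eq0 signr_eq0 /= -pmulrn.
by rewrite -(dvdn_pcharf (pchar_Fp p_pr)) dvdzE abszM absz_sign mul1n.
Qed.

(** By Gauss's lemma a rational factor may be taken integral; its leading coefficient divides that
    of [g], so its degree survives reduction modulo [p]. *)
Lemma irreducible_mod_p (p : nat) (g : {poly int}) : prime p ->
  ~~ (p %| lead_coef g)%Z -> irreducible_poly (map_poly intr g : {poly 'F_p}) ->
  irreducible_poly (map_poly intr g : {poly rat}).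
Proof.
move=> p_pr pl [sz1 girr].
have szE (u : {poly int}) : ~~ (p %| lead_coef u)%Z ->
    size (map_poly intr u : {poly 'F_p}) = size u.
  by move=> pu; rewrite size_poly_eq// intr_Fp_eq0.
have szQ (u : {poly int}) : size (map_poly intr u : {poly rat}) = size u.
  by rewrite size_map_inj_poly ?rmorph0//; exact: intr_inj.
split; first by rewrite szQ -(szE _ pl).
move=> q szq qg; have [q1 [a a0 qE] [u gE]] := dvdpP_rat_int qg.
have lE : lead_coef g = lead_coef q1 * lead_coef u by rewrite gE lead_coefM.
have pq : ~~ (p %| lead_coef q1)%Z.
  by apply: contra pl; rewrite lE => h; exact: dvdz_mulr.
have szq1 : size q = size q1 by rewrite qE size_scale// szQ.
have /eqp_size : (map_poly intr q1 : {poly 'F_p}) %= map_poly intr g.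
  apply: girr; first by rewrite szE// -szq1.
  by rewrite gE rmorphM dvdp_mulr.
rewrite !szE// => sz; rewrite -dvdp_size_eqp// szq1 sz szQ.
by [].
Qed.

Lemma irreducible_rat_separable (f : {poly rat}) : irreducible_poly f -> separable_poly f.
Proof.
move=> [sz firr]; rewrite separable_poly.unlock /coprimep.
apply/idPn => /firr /(_ (dvdp_gcdl _ _)) h.
have : f %| f^`() by rewrite -(eqp_dvdl _ h) dvdp_gcdr.
have f0 : f != 0 by rewrite -size_poly_gt0 ltnW.
have df0 : f^`() != 0.
  apply/eqP => /(congr1 (fun u : {poly rat} => u`_(size f).-2)).
  have e : ((size f).-2.+1 = (size f).-1)%N by case: (size f) sz => [|[]].
  rewrite coef0 coef_deriv e -lead_coefE => /eqP.
  rewrite mulrn_eq0 lead_coef_eq0 (negPf f0) orbF.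
  by case: (size f) sz => [|[]].
by move=> /(dvdp_leq df0); rewrite leqNgt lt_size_deriv.
Qed.

Lemma separable_roots_in_C (g : {poly int}) (n : nat) : size g = n.+1 -> separableZ g ->
  exists2 z : 'I_n -> algC, injective z &
    map_poly intr g = (lead_coef g)%:~R *: \prod_k ('X - (z k)%:P) :> {poly algC}.
Proof.
move=> szg sg.
have [rs rsE] := closed_field_poly_normal (map_poly intr g : {poly algC}).
have inj : injective (intr : int -> algC) by exact: intr_inj.
rewrite lead_coef_map_inj ?rmorph0// in rsE.
have l0 : (lead_coef g)%:~R != 0 :> algC.
  by rewrite intr_eq0 lead_coef_eq0 -size_poly_eq0 szg.
have szr : size rs = n.
  apply: succn_inj; rewrite -szg -(size_map_inj_poly inj) ?rmorph0// rsE.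
  by rewrite size_scale// size_prod_XsubC.
have rsU : uniq rs.
  rewrite -separable_prod_XsubC -(eqp_separable (eqp_scale _ l0)) -rsE.
  have := sg; rewrite /separableZ -(separable_map (ratr : {rmorphism rat -> algC})).
  by rewrite map_poly_rmorph_intr.
exists (fun k => rs`_k) => [i j /eqP|]; first by rewrite nth_uniq ?szr// => /eqP/val_inj.
rewrite rsE; congr (_ *: _).
by rewrite (big_nth 0) szr big_mkord.
Qed.

(** The leading coefficient is only required to be 1 modulo the three primes, since the nonmonic
    count lets it vary. Separability comes for free from irreducibility modulo [p1]. *)
Lemma galois_group_Sn_criterion (n p1 p2 p3 : nat) (g : {poly int})
    (c : 'F_p2) (h : {poly 'F_p2}) (q : {poly 'F_p3}) (cs : seq 'F_p3) :
  size g = n.+1 -> prime p1 -> prime p2 -> prime p3 ->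
  (p1 %| lead_coef g - 1)%Z -> (p2 %| lead_coef g - 1)%Z -> (p3 %| lead_coef g - 1)%Z ->
  irreducible_poly (map_poly intr g : {poly 'F_p1}) ->
  map_poly intr g = ('X - c%:P) * h -> irreducible_poly h -> ~~ root h c ->
  map_poly intr g = q * \prod_(x <- cs) ('X - x%:P) -> irreducible_poly q ->
  size q = 3 -> uniq cs ->
  separableZ g /\ galois_group_is_Sn n g.
Proof.
move=> szg pr1 pr2 pr3 l1 l2 l3 g1 g2 hirr hc g3 qirr szq csU.
have sg : separableZ g.
  apply: irreducible_rat_separable; apply: irreducible_mod_p g1 => //.
  apply/negP => p1l; have : (p1 %| lead_coef g - (lead_coef g - 1))%Z by exact: rpredB.
  rewrite opprB addrC subrK dvdz1 absz_nat.
  by move/eqP => p1E; move: pr1; rewrite p1E.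
split=> //; have a0 : lead_coef g != 0 by rewrite lead_coef_eq0 -size_poly_eq0 szg.
have [z zI gz] := separable_roots_in_C szg sg.
have [L [iota [r [gL rg gr _]]]] := splitting_field_in_C a0 zI gz.
exists L, r; split=> //.
pose G := group (galperm_group_set rg.1).
have [K1 [b1 [ch1 fb1 [s1 s1G sb1]]]] := frobenius_lift iota a0 rg gr pr1 l1.
have [j1 jP1] := Fp_embedding ch1.
have [K2 [b2 [ch2 fb2 [s2 s2G sb2]]]] := frobenius_lift iota a0 rg gr pr2 l2.
have [j2 jP2] := Fp_embedding ch2.
have [K3 [b3 [ch3 fb3 [s3 s3G sb3]]]] := frobenius_lift iota a0 rg gr pr3 l3.
have [j3 jP3] := Fp_embedding ch3.
rewrite -(map_poly_rmorph_intr j1) in fb1.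
rewrite -(map_poly_rmorph_intr j2) in fb2.
rewrite -(map_poly_rmorph_intr j3) in fb3.
have c_cyc := frobenius_irreducible ch1 jP1 fb1 sb1 g1.
have [i0 [si0 a_cyc]] := frobenius_linear_irreducible ch2 jP2 fb2 sb2 g2 hirr hc.
have [x [y [xy s3E]]] := frobenius_quadratic ch3 jP3 fb3 sb3 g3 qirr szq csU.
rewrite s3E in s3G.
exact: (@generate_Sn _ G s1 s2 i0 x y).
Qed.

(** * Polynomials over prime fields *)

(** The witness is the minimal polynomial of a generator of the field with $p^m$ elements. *)
Lemma exists_irreducible_poly (p m : nat) : prime p -> (0 < m)%N ->
  exists h : {poly 'F_p}, [/\ h \is monic, size h = m.+1 & irreducible_poly h].
Proof.
move=> p_pr m0; have [F chF cardF] := pPrimePowerField p_pr m0.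
pose L : splittingFieldType 'F_p := pPrimeCharType chF.
have dimL : \dim {:L} = m.
  by rewrite (pprimeChar_dimf chF) cardF pfactorK.
have gL : galois 1 {:L} by apply: finField_galois; exact: sub1v.
have /and3P[s1 sep _] := gL.
pose z := separable_generator 1 {:L}.
have gen : {:L}%VS = <<1; z>>%VS by exact: eq_adjoin_separable_generator.
have [h hE] := polyOver1P (minPolyOver 1 z).
have szh : size h = m.+1.
  rewrite -(size_map_poly (in_alg L)) -hE size_minPoly adjoin_degreeE -gen dimv1 divn1.
  by rewrite dimL.
exists h; split=> //.
  by rewrite -(map_monic (in_alg L)) -hE monic_minPoly.
split; first by rewrite szh.
move=> q szq qh.
have qK : map_poly (in_alg L) q \is a polyOver 1%AS by apply/polyOver1P; exists q.
have : map_poly (in_alg L) q %| minPoly 1 z by rewrite hE dvdp_map.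
move/(minPoly_irr qK); rewrite hE eqp_map => /orP[//|].
by rewrite -size_poly_eq1 size_map_poly (negPf szq).
Qed.

(** The unit group is cyclic of order $p - 1$; if $x = g^i$ and $x^{(p-1)/2} = 1$, then $p - 1$
    divides $i(p-1)/2$, so $i$ is even. *)
Lemma euler_criterion (p : nat) (x : 'F_p) : prime p -> odd p ->
  x ^+ p./2 = 1 -> exists s, x = s ^+ 2.
Proof.
move=> p_pr podd xE.
have p2 : p = p./2.*2.+1 by rewrite -[LHS]odd_double_half podd.
have h0 : (0 < p./2)%N by rewrite half_gt0; case: p p_pr podd {x xE p2} => [|[|[]]].
have x0 : x \is a GRing.unit.
  by rewrite unitfE; apply: contra_eqN xE => /eqP ->; rewrite expr0n gtn_eqF// eq_sym oner_eq0.
pose u : {unit 'F_p} := FinRing.Unit x0.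
have /cyclic.cyclicP[g gE] := cyclic.field_unit_group_cyclic [set: {unit 'F_p}]%G.
have ordg : #[g]%g = p./2.*2.
  rewrite orderE -gE card_finField_unit card_Fp//.
  by rewrite {1}p2.
have : u \in <[g]>%g by rewrite -gE inE.
case/cycleP => i uE.
have : (u ^+ p./2 = 1)%g by apply: val_inj; rewrite /= FinRing.val_unitX.
rewrite uE -expgM => /eqP; rewrite -cyclic.order_dvdn ordg -muln2 mulnC dvdn_pmul2r//.
case/dvdnP => k kE; exists (FinRing.uval g ^+ k).
rewrite -[LHS]/(FinRing.uval u) uE FinRing.val_unitX kE exprM.
by [].
Qed.

(** The residue form of the condition for [G1]. The square is required to be nonzero so that
    [interpolation_pm2] can divide by [g.[2]]. *)
Definition square_at_pm2 (F : fieldType) (g : {poly F}) : Prop :=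
  exists2 s, s != 0 & g.[2] * g.[-2] = s ^+ 2.

Lemma square_at_pm2M (F : fieldType) (g h : {poly F}) :
  square_at_pm2 g -> square_at_pm2 h -> square_at_pm2 (g * h).
Proof.
move=> [s s0 gE] [t t0 hE]; exists (s * t); first by rewrite mulf_neq0.
by rewrite !hornerM mulrACA gE hE exprMn.
Qed.

Lemma square_at_pm2_prod (F : fieldType) (T : eqType) (r : seq T) (g : T -> {poly F}) :
  {in r, forall x, square_at_pm2 (g x)} -> square_at_pm2 (\prod_(x <- r) g x).
Proof.
elim: r => [_|x r IH h].
  by rewrite big_nil; exists 1; rewrite ?oner_neq0// !hornerE expr1n.
rewrite big_cons; apply: square_at_pm2M; first by apply: h; rewrite mem_head.
by apply: IH => y yr; apply: h; rewrite inE yr orbT.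
Qed.

(* [x^2 - 4 = (w - w^-1)^2] at [x = w + w^-1]. *)
Lemma square_at_pm2_XsubC (F : fieldType) (w : F) : w != 0 -> w ^+ 2 != 1 ->
  square_at_pm2 ('X - (w + w^-1)%:P).
Proof.
move=> w0 w1; exists (w - w^-1).
  apply: contra w1; rewrite subr_eq0 => /eqP e.
  by rewrite expr2 {2}e mulfV.
by rewrite !hornerXsubC; field.
Qed.

(** The remainder modulo $X^2 - 4$ is determined by the values at $\pm 2$. With $u$ normalized to 1,
    the equations $4d = g(2)$ and $4dv^2 = g(-2)$ are solved by $d = g(2)/4$ and $v = s/g(2)$. *)
Lemma interpolation_pm2 (F : fieldType) (n : nat) (g : {poly F}) :
  (2 : F) != 0 -> (2 <= n)%N -> g \is monic -> size g = n.+1 -> square_at_pm2 g ->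
  exists (Q : {poly F}) (d v : F), [/\ Q \is monic, size Q = n.-1 &
    g = ('X^2 - 4%:P) * Q + (d * (1 - v ^+ 2)) *: 'X + (2 * d * (1 + v ^+ 2))%:P].
Proof.
move=> two n2 gm szg [s s0 gE].
have four : (4 : F) != 0 by rewrite (_ : 4 = 2 * 2) ?mulf_neq0// -natrM.
pose D : {poly F} := 'X^2 - 4%:P.
have szD : size D = 3 by rewrite size_XnsubC.
have Dm : D \is monic by rewrite monicXnsubC.
have D0 : D != 0 by rewrite monic_neq0.
pose r := g %% D.
have gr : g = D * (g %/ D) + r by rewrite mulrC -divp_eq.
have szr : (size r <= 2)%N by have := ltn_modp g D; rewrite D0 szD ltnS.
have rE : r = r`_1 *: 'X + (r`_0)%:P.
  apply/polyP => i; rewrite coefD coefZ coefX coefC.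
  case: i => [|[|i]] /=; rewrite ?mulr0 ?mulr1 ?addr0 ?add0r//.
  by rewrite nth_default// (leq_trans szr).
have ev x : x ^+ 2 = 4 -> g.[x] = r`_1 * x + r`_0.
  move=> x2; have Dx : D.[x] = 0 by rewrite !hornerE x2 subrr.
  by rewrite {1}gr hornerD hornerM Dx mul0r add0r {1}rE !hornerE.
have g2 : g.[2] = r`_1 * 2 + r`_0 by apply: ev; rewrite -natrX.
have gm2 : g.[-2] = - (r`_1 * 2) + r`_0.
  by rewrite ev ?mulrN// sqrrN -natrX.
have g2n : g.[2] != 0.
  by apply: contra s0 => /eqP e; rewrite -sqrf_eq0 -gE e mul0r.
have szQ : size (g %/ D) = n.-1 by rewrite size_divp// szg szD; lia.
exists (g %/ D), (g.[2] / 4), (s / g.[2]); split=> //.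
  have Q0 : g %/ D != 0 by rewrite -size_poly_gt0 szQ; lia.
  have := monicP gm; rewrite monicE {1}gr lead_coefDl ?lead_coef_monicM//; first by move->.
  by apply: leq_ltn_trans szr _; rewrite size_monicM// szD szQ; lia.
rewrite {1}gr -addrA rE; congr (_ + (_ *: _ + polyC _)).
  transitivity ((g.[2] - g.[-2]) / 4); first by rewrite g2 gm2; field.
  by rewrite expr_div_n -gE; field; rewrite ?two ?g2n ?four.
transitivity ((g.[2] + g.[-2]) / 2); first by rewrite g2 gm2; field.
by rewrite expr_div_n -gE; field; rewrite ?two ?g2n ?four.
Qed.

Section ModP.
Variable p : nat.
Hypotheses (p_pr : prime p) (p5 : (5 < p)%N).

Let podd : odd p.
Proof. by case: (even_prime p_pr) => // p2; move: p5; rewrite p2. Qed.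

Let natFp_eq0 k : ((k%:R : 'F_p) == 0) = (p %| k)%N.
Proof. by rewrite (dvdn_pcharf (pchar_Fp p_pr)). Qed.

Let natFp_neq0 k : (0 < k < p)%N -> (k%:R : 'F_p) != 0.
Proof. by move=> /andP[k0 kp]; rewrite natFp_eq0 gtnNdvd. Qed.

Lemma two_neq0_Fp : (2 : 'F_p) != 0. Proof. by apply: natFp_neq0; lia. Qed.

(* If every shift gave a non-square, multiplying over the odd number [p] of
   shifts would make the square of [\prod_c h.[c]] a non-square. *)
Lemma exists_square_shift (h : {poly 'F_p}) : (forall c, ~~ root h c) ->
  exists c, square_at_pm2 (h \Po ('X + c%:P)).
Proof.
move=> hn; pose m := p./2.
have p2m : (m * 2 = p.-1)%N by rewrite /m -[in RHS](odd_double_half p) podd -muln2.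
have pow1 (x : 'F_p) : x != 0 -> x ^+ m ^+ 2 = 1.
  move=> x0; rewrite -exprM p2m; apply: (mulfI x0).
  by rewrite -exprS prednK ?prime_gt0// mulr1 -[RHS]expf_card card_Fp.
have h0 c : h.[c] != 0 by exact: hn.
have [[c cE]|nc] := pselect (exists c, (h.[c + 2] * h.[c - 2]) ^+ m = 1).
  have [s sE] := euler_criterion p_pr podd cE.
  exists c; exists s.
    by rewrite -sqrf_eq0 -sE mulf_neq0.
  by rewrite !horner_comp !hornerE addrC [-2 + c]addrC.
have all c : (h.[c + 2] * h.[c - 2]) ^+ m = -1.
  have /eqP := pow1 _ (mulf_neq0 (h0 (c + 2)) (h0 (c - 2))).
  rewrite -subr_eq0 subr_sqr_1 mulf_eq0 subr_eq0 => /orP[/eqP e|].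
    by case: nc; exists c.
  by rewrite addr_eq0 => /eqP.
have : \prod_c (h.[c + 2] * h.[c - 2]) ^+ m = -1.
  by rewrite (eq_bigr (fun _ => -1)) // prodr_const card_Fp// -signr_odd podd.
have prodE a : \prod_c h.[c + a] = \prod_c h.[c] by rewrite [RHS](reindex_inj (addIr a)).
rewrite prodrXl big_split /= !prodE -expr2 exprAC pow1; last by apply/prodf_neq0 => c _.
by move/eqP; rewrite -subr_eq0 opprK => e; case: (negP two_neq0_Fp).
Qed.

Lemma size_comp_XaddC (F : fieldType) (h : {poly F}) (c : F) :
  size (h \Po ('X + c%:P)) = size h.
Proof. by rewrite size_comp_poly2// size_XaddC. Qed.

Lemma irreducible_comp_XaddC (F : fieldType) (h : {poly F}) (c : F) :
  irreducible_poly h -> irreducible_poly (h \Po ('X + c%:P)).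
Proof.
move=> [sz hirr]; split; first by rewrite size_comp_XaddC.
move=> q szq qh; rewrite -dvdp_size_eqp// size_comp_XaddC.
pose q' := q \Po ('X - c%:P).
have szq' : size q' = size q by rewrite /q' -polyCN size_comp_XaddC.
rewrite -szq'; apply/eqP/eqp_size/hirr; first by rewrite szq'.
case/dvdpP: qh => k /(congr1 (comp_poly ('X - c%:P))).
by rewrite comp_polyXaddC_K comp_polyM => ->; rewrite dvdp_mulIr.
Qed.

Lemma exists_irreducible_square (m : nat) : (2 <= m)%N ->
  exists h : {poly 'F_p},
  [/\ h \is monic, size h = m.+1, irreducible_poly h & square_at_pm2 h].
Proof.
move=> m2; have m0 : (0 < m)%N by lia.
have [h [hm szh hirr]] := exists_irreducible_poly p_pr m0.
have [c sq] : exists c, square_at_pm2 (h \Po ('X + c%:P)).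
  apply: exists_square_shift => c; apply/negP.
  rewrite root_factor_theorem => /(hirr.2 _); rewrite size_XsubC => /(_ isT).
  by move/eqp_size; rewrite size_XsubC szh => -[]; lia.
exists (h \Po ('X + c%:P)); split=> //; last exact: irreducible_comp_XaddC.
  by rewrite monicE lead_coef_comp ?size_XaddC// (monicP hm) lead_coefXaddC expr1n mulr1.
by rewrite size_comp_XaddC.
Qed.

Lemma exists_linear_irreducible_square (n : nat) : (2 <= n)%N ->
  exists (c : 'F_p) (h : {poly 'F_p}),
  [/\ ('X - c%:P) * h \is monic, size (('X - c%:P) * h) = n.+1,
      irreducible_poly h, ~~ root h c & square_at_pm2 (('X - c%:P) * h)].
Proof.
move=> n2; have t2 := two_neq0_Fp; have t3 : (3 : 'F_p) != 0 by apply: natFp_neq0; lia.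
(* This is $w + 1/w$ for $w = 2$, admissible because $w^2 - 1 = 3$ is nonzero. *)
pose c : 'F_p := 2 + 2^-1.
have cm : 'X - c%:P \is monic by exact: monicXsubC.
have csq : square_at_pm2 ('X - c%:P).
  apply: square_at_pm2_XsubC => //; rewrite -subr_eq0 (_ : _ - 1 = 3) //; ring.
suff [h [hm szh hirr hc hsq]] : exists h : {poly 'F_p}, [/\ h \is monic, size h = n,
    irreducible_poly h, ~~ root h c & square_at_pm2 h].
  exists c, h; split=> //; first by rewrite rpredM.
    by rewrite size_Mmonic ?polyXsubC_eq0// size_XsubC szh.
  exact: square_at_pm2M.
(* For [n = 2] the cofactor is linear too, and $w = 3$ is used, with $w^2 - 1 = 8$. After
   multiplication by 6, the two roots coincide only if $15 = 20$, that is in characteristic 5. *)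
have [->|n3] : n = 2 \/ (3 <= n)%N by lia.
  exists ('X - (3 + 3^-1)%:P); split; [exact: monicXsubC|by rewrite size_XsubC|exact: irredp_XsubC| |].
    rewrite root_XsubC; apply/eqP => e.
    have : (5 : 'F_p) = 0.
      have : c * 6 = (3 + 3^-1) * 6 by rewrite e.
      rewrite /c => h; have : (15 : 'F_p) = 20.
        by transitivity ((2 + 2^-1) * 6 : 'F_p); [field | rewrite h; field].
      by move/eqP; rewrite -subr_eq0 => /eqP h5; rewrite -[RHS]oppr0 -h5; ring.
    by move/eqP; rewrite natFp_eq0 gtnNdvd.
  apply: square_at_pm2_XsubC => //; rewrite -subr_eq0 (_ : _ - 1 = 8); last by ring.
  by rewrite (_ : 8 = 2 * 2 * 2) ?mulf_neq0// -!natrM.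
have n1 : (2 <= n.-1)%N by lia.
have [h [hm szh hirr hsq]] := exists_irreducible_square n1.
exists h; split=> //; first by rewrite szh; lia.
apply/negP; rewrite root_factor_theorem => /(hirr.2 _); rewrite size_XsubC => /(_ isT).
by move/eqp_size; rewrite size_XsubC szh; lia.
Qed.

(** The linear factors have the roots $i + 1/i$ for $2 \le i < n$. They are distinct since the
    difference for $i$ and $j$, multiplied by $ij$, is $(i-j)(ij-1)$, and $ij < n^2 < p$. *)
Lemma exists_quadratic_split_square (n : nat) : (2 <= n)%N -> (n ^ 2 < p)%N ->
  exists (q : {poly 'F_p}) (cs : seq 'F_p), let g := q * \prod_(c <- cs) ('X - c%:P) in
  [/\ g \is monic, size g = n.+1, irreducible_poly q, size q = 3 & uniq cs /\ square_at_pm2 g].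
Proof.
move=> n2 np; have [q [qm szq qirr qsq]] := exists_irreducible_square (leqnn 2).
pose w (i : nat) : 'F_p := i%:R + i%:R^-1.
have w0 i : i \in iota 2 (n - 2) -> (i%:R : 'F_p) != 0.
  by rewrite mem_iota => h; apply: natFp_neq0; nia.
exists q, [seq w i | i <- iota 2 (n - 2)].
have m2 : \prod_(c <- [seq w i | i <- iota 2 (n - 2)]) ('X - c%:P) \is monic.
  exact: monic_prod_XsubC.
split=> //; first by rewrite rpredM.
  by rewrite size_Mmonic ?monic_neq0// szq size_prod_XsubC size_map size_iota; lia.
split.
  rewrite map_inj_in_uniq ?iota_uniq// => i j ii jj e.
  have i0 := w0 _ ii; have j0 := w0 _ jj.
  have : (i%:R - j%:R) * ((i * j)%:R - 1) = 0 :> 'F_p.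
    have -> : (i%:R - j%:R) * ((i * j)%:R - 1) = (w i - w j) * (i * j)%:R :> 'F_p.
      by rewrite /w natrM; field; rewrite i0 j0.
    by rewrite e subrr mul0r.
  move: ii jj; rewrite !mem_iota => ii jj /eqP; rewrite mulf_eq0 => /orP[].
    wlog ij : i j {e i0 j0} ii jj / (j <= i)%N.
      move=> H; case: (leqP j i) => [ij|/ltnW ji]; first exact: H.
      by rewrite -oppr_eq0 opprB => h; apply/esym/H.
    rewrite -natrB// natFp_eq0 => /dvdnP[[|k]]; first by lia.
    by nia.
  have -> : (i * j)%:R - 1 = (i * j - 1)%:R :> 'F_p by rewrite natrB//; nia.
  by rewrite natFp_eq0 gtnNdvd//; nia.
apply: square_at_pm2M => //; rewrite big_map; apply: square_at_pm2_prod => i ii.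
apply: square_at_pm2_XsubC; first exact: w0.
rewrite mem_iota in ii; rewrite -subr_eq0.
have -> : i%:R ^+ 2 - 1 = (i ^ 2 - 1)%:R :> 'F_p by rewrite natrB ?natrX//; nia.
by apply: natFp_neq0; apply/andP; split; nia.
Qed.

End ModP.

(** * Integral polynomials with full Galois group *)

(* The polynomials of degree [n] with values [4 d u^2] at [2] and [4 d v^2] at [-2]. *)
Definition square_family (R : nzRingType) (Q : {poly R}) (d u v : R) : {poly R} :=
  ('X^2 - 4%:P) * Q + (d * (u ^+ 2 - v ^+ 2)) *: 'X + (2 * d * (u ^+ 2 + v ^+ 2))%:P.

Lemma map_square_family (R S : nzRingType) (phi : {rmorphism R -> S}) (Q : {poly R}) (d u v : R) :
  map_poly phi (square_family Q d u v) = square_family (map_poly phi Q) (phi d) (phi u) (phi v).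
Proof.
have e1 : phi (d * (u ^+ 2 - v ^+ 2)) = phi d * (phi u ^+ 2 - phi v ^+ 2).
  by rewrite rmorphM rmorphB !rmorphXn.
have e2 : phi (2 * d * (u ^+ 2 + v ^+ 2)) = 2 * phi d * (phi u ^+ 2 + phi v ^+ 2).
  by rewrite !rmorphM rmorph_nat rmorphD !rmorphXn.
rewrite /square_family rmorphD [X in X + _ = _]rmorphD rmorphM; congr (_ * _ + _ + _).
- rewrite rmorphB; congr (_ - _); first exact: map_polyXn.
  by rewrite [LHS]map_polyC /= rmorph_nat.
- by rewrite [LHS]map_polyZ map_polyX; congr (_ *: _); exact: e1.
- by rewrite [LHS]map_polyC; congr (_%:P); exact: e2.
Qed.

Lemma chinese3_Fp (p1 p2 p3 : nat) (a : 'F_p1) (b : 'F_p2) (c : 'F_p3) :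
  prime p1 -> prime p2 -> prime p3 -> (p1 < p2)%N -> (p2 < p3)%N ->
  exists x : int, [/\ x%:~R = a, x%:~R = b & x%:~R = c].
Proof.
move=> pr1 pr2 pr3 p12 p23.
have cop q1 q2 : prime q1 -> prime q2 -> (q1 < q2)%N -> coprime q1 q2.
  by move=> prq1 prq2 q12; rewrite prime_coprime// dvdn_prime2//; lia.
have c12 := cop _ _ pr1 pr2 p12; have c23 := cop _ _ pr2 pr3 p23.
have c13 : coprime p1 p3 by apply: cop => //; lia.
have c123 : coprime (p1 * p2) p3 by rewrite coprimeMl c13.
pose y := chinese p1 p2 a b; pose x := chinese (p1 * p2) p3 y c.
have castE p (e : 'F_p) (m : nat) : prime p -> m = e %[mod p] -> m%:R = e.
  by move=> p_pr h; rewrite -[RHS]natr_Zp -(Fp_nat_mod p_pr m) h Fp_nat_mod.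
have xy : x = y %[mod p1 * p2] by exact: chinese_modl.
have xyd q : (q %| p1 * p2)%N -> x = y %[mod q].
  by move=> qd; rewrite -(modn_dvdm x qd) xy modn_dvdm.
exists x%:Z; split; rewrite -pmulrn; apply: castE => //.
- by rewrite xyd ?dvdn_mulr// chinese_modl.
- by rewrite xyd ?dvdn_mull// chinese_modr.
- exact: chinese_modr.
Qed.

Lemma good_residues (n : nat) : (2 <= n)%N ->
  exists (M : nat) (Q0 : {poly int}) (d0 v0 : int),
  [/\ (0 < M)%N, Q0 \is monic, size Q0 = n.-1 &
   forall (Q : {poly int}) (d u v : int),
     (forall i, (M %| Q`_i - Q0`_i)%Z) -> (M %| d - d0)%Z -> (M %| u - 1)%Z ->
     (M %| v - v0)%Z -> size (square_family Q d u v) = n.+1 ->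
     separableZ (square_family Q d u v) /\ galois_group_is_Sn n (square_family Q d u v)].
Proof.
move=> n2.
(* Exceeding 5 keeps 2, 3 and 5 invertible for the explicit linear factors; exceeding [n ^ 2]
   separates the roots $i + 1/i$. *)
have [p1 p1n pr1] := prime_above (maxn 5 (n ^ 2)).
have [p2 p12 pr2] := prime_above p1.
have [p3 p23 pr3] := prime_above p2.
have [p15 p25 p35] : [/\ (5 < p1)%N, (5 < p2)%N & (5 < p3)%N] by split; lia.
have p3n : (n ^ 2 < p3)%N by lia.
have [g1 [g1m szg1 g1irr g1sq]] := exists_irreducible_square pr1 p15 n2.
have [Q1 [d1 [v1 [Q1m szQ1 g1E]]]] := interpolation_pm2 (two_neq0_Fp pr1 p15) n2 g1m szg1 g1sq.
have [c [h [g2m szg2 hirr hc g2sq]]] := exists_linear_irreducible_square pr2 p25 n2.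
have [Q2 [d2 [v2 [Q2m szQ2 g2E]]]] := interpolation_pm2 (two_neq0_Fp pr2 p25) n2 g2m szg2 g2sq.
have [q [cs [g3m szg3 qirr szq [csU g3sq]]]] := exists_quadratic_split_square pr3 p35 n2 p3n.
have [Q3 [d3 [v3 [Q3m szQ3 g3E]]]] := interpolation_pm2 (two_neq0_Fp pr3 p35) n2 g3m szg3 g3sq.
have crt a b e := chinese3_Fp a b e pr1 pr2 pr3 p12 p23.
have [d0 [d01 d02 d03]] := crt d1 d2 d3.
have [v0 [v01 v02 v03]] := crt v1 v2 v3.
have /boolp.choice[qc qcE] := fun i => crt Q1`_i Q2`_i Q3`_i.
(* The top coefficient is the integer 1 and not an arbitrary lift of the residue 1, so that monic
   members of the family exist. *)
pose Q0 : {poly int} := \poly_(i < n.-1) (if i == n.-2 then 1 else qc i).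
have en : (n.-1 = n.-2.+1)%N by case: (n) n2 => [|[]].
have szQ0 : size Q0 = n.-1 by rewrite /Q0 en size_poly_eq//= eqxx oner_eq0.
have Q0E i : [/\ (Q0`_i)%:~R = Q1`_i, (Q0`_i)%:~R = Q2`_i & (Q0`_i)%:~R = Q3`_i].
  rewrite coef_poly; case: ltnP => [ilt|ige].
    case: eqP => [ie|_] //.
    split; rewrite ie; [rewrite -(monicP Q1m) | rewrite -(monicP Q2m) | rewrite -(monicP Q3m)];
      by rewrite lead_coefE ?szQ1 ?szQ2 ?szQ3.
  by split; rewrite nth_default ?szQ1 ?szQ2 ?szQ3.
exists (p1 * p2 * p3)%N, Q0, d0, v0; split=> //.
- by rewrite !muln_gt0 !prime_gt0.
- by rewrite monicE lead_coefE szQ0 coef_poly en ltnSn/= eqxx.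
move=> Q d u v QQ dd uu vv szg.
have red p (a b : int) : prime p -> (p %| p1 * p2 * p3)%N ->
    ((p1 * p2 * p3)%N %| a - b)%Z -> a%:~R = b%:~R :> 'F_p.
  move=> p_pr pd ab; apply/eqP; rewrite -subr_eq0 -intrB intr_Fp_eq0//.
  exact: dvdz_trans ab.
have dp1 : (p1 %| p1 * p2 * p3)%N by rewrite -mulnA dvdn_mulr.
have dp2 : (p2 %| p1 * p2 * p3)%N by rewrite mulnAC dvdn_mull.
have dp3 : (p3 %| p1 * p2 * p3)%N by rewrite dvdn_mull.
have redg p (Qp : {poly 'F_p}) dp vp : prime p -> (p %| p1 * p2 * p3)%N ->
    (forall i, (Q0`_i)%:~R = Qp`_i) -> d0%:~R = dp -> v0%:~R = vp ->
    map_poly intr (square_family Q d u v) =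
    ('X^2 - 4%:P) * Qp + (dp * (1 - vp ^+ 2)) *: 'X + (2 * dp * (1 + vp ^+ 2))%:P.
  move=> p_pr pd Qpi <- <-.
  rewrite map_square_family; transitivity (square_family Qp d0%:~R 1 v0%:~R).
    congr square_family; [|exact: red dd|exact: (red p u 1)|exact: red vv].
    by apply/polyP => i; rewrite coef_map -Qpi; exact: red (QQ i).
  by rewrite /square_family expr1n.
have G1 : map_poly intr (square_family Q d u v) = g1 :> {poly 'F_p1}.
  by rewrite [RHS]g1E; apply: redg => // i; case: (Q0E i).
have G2 : map_poly intr (square_family Q d u v) = ('X - c%:P) * h :> {poly 'F_p2}.
  by rewrite [RHS]g2E; apply: redg => // i; case: (Q0E i).
have G3 : map_poly intr (square_family Q d u v) = q * \prod_(x <- cs) ('X - x%:P) :> {poly 'F_p3}.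
  by rewrite [RHS]g3E; apply: redg => // i; case: (Q0E i).
have lead p (gp : {poly 'F_p}) : prime p -> gp \is monic -> size gp = n.+1 ->
    map_poly intr (square_family Q d u v) = gp -> (p %| lead_coef (square_family Q d u v) - 1)%Z.
  move=> p_pr gm szgp gE.
  have : (lead_coef (square_family Q d u v))%:~R = 1 :> 'F_p.
    by transitivity (lead_coef gp); [rewrite !lead_coefE szgp szg -gE coef_map | exact/monicP].
  by move/eqP; rewrite -subr_eq0 -[1]/(1%:~R) -intrB intr_Fp_eq0.
apply: (galois_group_Sn_criterion szg pr1 pr2 pr3 _ _ _ _ G2 hirr hc G3 qirr szq csU).
- exact: lead G1.
- exact: lead G2.
- exact: lead G3.
- by rewrite G1.
Qed.

(** * Reciprocal polynomials *)

(* [x^n g(x + 1/x)] as a polynomial. *)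
Definition reciprocal_lift (n : nat) (g : {poly int}) : {poly int} :=
  \sum_(i < n.+1) g`_i *: ('X^(n - i) * ('X^2 + 1) ^+ i).

Lemma evalZ_sum (K : fieldType) (I : finType) (F : I -> {poly int}) (y : K) :
  evalZ (\sum_i F i) y = \sum_i evalZ (F i) y.
Proof. by rewrite /evalZ rmorph_sum horner_sum. Qed.

Lemma evalZ_term (K : fieldType) (c : int) (i j : nat) (y : K) :
  evalZ (c *: ('X^j * ('X^2 + 1) ^+ i)) y = c%:~R * (y ^+ j * (y ^+ 2 + 1) ^+ i).
Proof.
have m1 : map_poly intr ('X^2 + 1) = 'X^2 + 1 :> {poly K}.
  by rewrite rmorphD rmorph1; congr (_ + _); exact: map_polyXn.
have m2 : map_poly intr ('X^j * ('X^2 + 1) ^+ i) = 'X^j * ('X^2 + 1) ^+ i :> {poly K}.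
  rewrite rmorphM; congr (_ * _); first exact: map_polyXn.
  by rewrite rmorphXn; congr (_ ^+ _); exact: m1.
by rewrite /evalZ map_polyZ m2 !hornerE.
Qed.

Lemma evalZ_reciprocal_lift (K : fieldType) (n : nat) (g : {poly int}) (y : K) :
  (size g <= n.+1)%N -> y != 0 ->
  evalZ (reciprocal_lift n g) y = y ^+ n * evalZ g (y + y^-1).
Proof.
move=> szg y0; have gE : evalZ g (y + y^-1) = \sum_(i < n.+1) (g`_i)%:~R * (y + y^-1) ^+ i.
  rewrite /evalZ (horner_coef_wide _ (leq_trans (size_poly _ _) szg)).
  by apply: eq_bigr => i _; rewrite coef_map.
rewrite gE mulr_sumr evalZ_sum; apply: eq_bigr => i _; rewrite evalZ_term.
have ile : (i <= n)%N by rewrite -ltnS.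
have -> : y ^+ n = y ^+ (n - i) * y ^+ i by rewrite -exprD subnK.
rewrite [RHS]mulrCA; congr (_ * _).
rewrite -mulrA -exprMn; congr (_ * _); congr (_ ^+ _).
by rewrite mulrDr mulfV// expr2.
Qed.

(** The summand of index $i$ is $g_i$ times a monic polynomial of degree $n + i$, so the leading
    term of [g] alone decides. *)
Lemma size_reciprocal_lift (n : nat) (g : {poly int}) : g != 0 -> (size g <= n.+1)%N ->
  size (reciprocal_lift n g) = (n + size g)%N /\
  lead_coef (reciprocal_lift n g) = lead_coef g.
Proof.
move=> g0 szg; case sg : (size g) szg => [|k] kn.
  by move/eqP: sg; rewrite size_poly_eq0 (negPf g0).
have m1 : ('X^2 + 1 : {poly int}) \is monic by exact: (monicXnaddC 1).
have s1 : size ('X^2 + 1 : {poly int}) = 3 by rewrite (size_XnaddC 1).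
have szt i : (i <= n)%N -> size ('X^(n - i) * ('X^2 + 1) ^+ i : {poly int}) = (n + i).+1.
  move=> ile.
  have mi : ('X^2 + 1 : {poly int}) ^+ i \is monic by rewrite rpredX.
  have := size_exp ('X^2 + 1 : {poly int}) i; rewrite s1 /= => si.
  have e : size (('X^2 + 1 : {poly int}) ^+ i) = (2 * i).+1.
    by rewrite -si prednK// size_poly_gt0 monic_neq0.
  by rewrite size_monicM ?monicXn ?monic_neq0// size_polyXn e addSn /= addnS; congr S; lia.
pose t i : {poly int} := 'X^(n - i) * ('X^2 + 1) ^+ i.
have fE : reciprocal_lift n g = g`_k *: t k + \sum_(i < k) g`_i *: t i.
  rewrite [RHS]addrC; transitivity (\sum_(i < k.+1) g`_i *: t i); last by rewrite big_ord_recr.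
  rewrite (big_ord_widen _ (fun i => g`_i *: t i) kn) [RHS]big_mkcond.
  apply: eq_bigr => i _; case: ifP => // /negbT; rewrite -leqNgt => ge.
  by rewrite nth_default ?scale0r// sg.
have gk : g`_k = lead_coef g by rewrite lead_coefE sg.
have gk0 : g`_k != 0 by rewrite gk lead_coef_eq0.
have sk : size (g`_k *: t k) = (n + k).+1 by rewrite size_scale// szt.
have s2 : (size (\sum_(i < k) g`_i *: t i)%R < size (g`_k *: t k))%N.
  rewrite sk ltnS; apply: (leq_trans (size_sum _ _ _)); apply/bigmax_leqP => i _.
  by apply: (leq_trans (size_scale_leq _ _)); rewrite szt; have := ltn_ord i; lia.
rewrite fE size_polyDl// sk addnS; split=> //.
rewrite lead_coefDl// lead_coefZ -[RHS]mulr1 gk; congr (_ * _).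
by apply/eqP; rewrite -monicE /t rpredM ?monicXn//; exact: rpredX.
Qed.

Lemma reciprocal_liftB (n : nat) (g h : {poly int}) :
  reciprocal_lift n (g - h) = reciprocal_lift n g - reciprocal_lift n h.
Proof.
rewrite /reciprocal_lift -sumrB; apply: eq_bigr => i _.
by rewrite coefB scalerBl.
Qed.

Lemma reciprocal_lift_inj (n : nat) (g h : {poly int}) :
  (size g <= n.+1)%N -> (size h <= n.+1)%N ->
  reciprocal_lift n g = reciprocal_lift n h -> g = h.
Proof.
move=> sg sh e; apply/eqP; rewrite -subr_eq0; apply: contraT => gh0.
have szB : (size (g - h)%R <= n.+1)%N by rewrite (leq_trans (size_polyD _ _))// size_polyN geq_max sg.
have [+ _] := size_reciprocal_lift gh0 szB.
rewrite reciprocal_liftB e subrr size_poly0 => /esym/eqP.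
by rewrite addn_eq0 size_poly_eq0 (negPf gh0) andbF.
Qed.

Lemma leq_absz_sum (I : finType) (F : I -> int) : (absz (\sum_i F i)%R <= \sum_i absz (F i))%N.
Proof.
elim/big_ind2: _ => // x1 x2 y1 y2 h1 h2.
by apply: leq_trans (leq_add h1 h2); rewrite -lez_nat PoszD !abszE ler_normD.
Qed.

Lemma reciprocal_lift_bound (n : nat) : exists C : nat, forall (g : {poly int}) (B : nat),
  (forall i, absz (g`_i)%R <= B)%N -> forall j, (absz ((reciprocal_lift n g)`_j)%R <= C * B)%N.
Proof.
pose t (i : nat) : {poly int} := 'X^(n - i) * ('X^2 + 1) ^+ i.
exists (\sum_(i < n.+1) \sum_(j < size (t i)) absz ((t i)`_j)%R)%N => g B gB j.
rewrite coef_sum; apply: leq_trans (leq_absz_sum _) _.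
rewrite big_distrl /=; apply: leq_sum => i _; rewrite coefZ abszM mulnC leq_mul//.
have [jl|jg] := ltnP j (size (t i)); last by rewrite nth_default.
by rewrite (bigD1 (Ordinal jl))//= leq_addr.
Qed.

Lemma xF_neq0 : xF != 0.
Proof. by rewrite /xF tofrac_eq0 polyX_eq0. Qed.

Lemma trace_poly_reciprocal_lift (n : nat) (g : {poly int}) : size g = n.+1 ->
  trace_poly n (reciprocal_lift n g) g.
Proof.
by move=> sg; split=> //; rewrite evalZ_reciprocal_lift ?sg// xF_neq0.
Qed.

Lemma reciprocal_reciprocal_lift (n : nat) (g : {poly int}) : (size g <= n.+1)%N ->
  reciprocal n (reciprocal_lift n g).
Proof.
move=> sg; rewrite /reciprocal !evalZ_reciprocal_lift ?invr_eq0 ?xF_neq0// invrK.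
rewrite mulrA [xF^-1 + _]addrC; congr (_ * _).
by rewrite mul2n -addnn exprD exprVn mulfK// expf_neq0 ?xF_neq0.
Qed.

(** * The subgroup G1 and squares *)

Lemma intr_rat_ext_eq0 (L : fieldExtType rat) (c : int) : (c%:~R == 0 :> L) = (c == 0).
Proof. by rewrite -(rmorph_int (in_alg L)) fmorph_eq0 intr_eq0. Qed.

Lemma intr_rat_ext_inj (L : fieldExtType rat) : injective (intr : int -> L).
Proof.
move=> x y /eqP; rewrite -subr_eq0 -intrB intr_rat_ext_eq0 subr_eq0.
by move/eqP.
Qed.

Lemma factored_of_roots (L : fieldType) (T : finType) (f : {poly int}) (r : T -> L) :
  injective (intr : int -> L) -> injective r -> (forall k, evalZ f (r k) = 0) ->
  size f = #|T|.+1 ->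
  map_poly intr f = (lead_coef f)%:~R *: \prod_k ('X - (r k)%:P) :> {poly L}.
Proof.
move=> inj rI r0 szf; rewrite -(lead_coef_map_inj inj) ?rmorph0//.
have -> : \prod_k ('X - (r k)%:P) = \prod_(x <- codom r) ('X - x%:P) by rewrite big_image.
apply: all_roots_prod_XsubC.
- by rewrite size_map_inj_poly ?rmorph0// szf size_codom.
- by apply/allP => _ /codomP[k ->]; apply/eqP/r0.
- by rewrite uniq_rootsE map_inj_uniq ?enum_uniq.
Qed.

Lemma root_labelling_factored (L : splittingFieldType rat) (T : finType)
    (f : {poly int}) (r : T -> L) :
  root_labelling f r -> size f = #|T|.+1 ->
  map_poly intr f = (lead_coef f)%:~R *: \prod_k ('X - (r k)%:P) :> {poly L}.
Proof.
move=> [rI rE]; apply: factored_of_roots => //; first exact: intr_rat_ext_inj.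
by move=> k; apply/rE; exists k.
Qed.

Lemma F2_cases (e : 'F_2) : e = 0 \/ e = 1.
Proof. by case: e => [[|[|//]]] h; [left|right]; apply: val_inj. Qed.

Lemma prod_F2 (R : comNzRingType) (F : 'F_2 -> R) : \prod_e F e = F 0 * F 1.
Proof.
rewrite (bigD1 0)//= (bigD1 1)//= big1 ?mulr1// => e.
by case: (F2_cases e) => ->.
Qed.

Section PairedRoots.
Variables (L : splittingFieldType rat) (n : nat) (f : {poly int}).
Variable r : 'I_n * 'F_2 -> L.
Hypotheses (rf : root_labelling f r) (r01 : forall i, r (i, 0) * r (i, 1) = 1).
Hypothesis szf : size f = (2 * n).+1.

Definition pair_delta : L := \prod_i (r (i, 0) - r (i, 1)).

Lemma pair_delta_neq0 : pair_delta != 0.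
Proof.
apply/prodf_neq0 => i _; rewrite subr_eq0; apply/eqP => /rf.1 /eqP.
by rewrite xpair_eqE eqxx.
Qed.

(** A pair with $xy = 1$ contributes $(1-x)(1-y)(-1-x)(-1-y) = (1-x^2)(1-y^2) = -(x-y)^2$. *)
Lemma evalZ_pm1_pair_delta :
  evalZ f (1 : L) * evalZ f (-1) = (-1) ^+ n * ((lead_coef f)%:~R * pair_delta) ^+ 2.
Proof.
have card2 : #|{: 'I_n * 'F_2}| = (2 * n)%N by rewrite card_prod card_ord card_Fp// mulnC.
have fE := root_labelling_factored rf (etrans szf (congr1 S (esym card2))).
have ev x : evalZ f x = (lead_coef f)%:~R * \prod_i ((x - r (i, 0)) * (x - r (i, 1))).
  rewrite /evalZ fE hornerZ horner_prod; congr (_ * _).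
  transitivity (\prod_(i < n) \prod_(e : 'F_2) ('X - (r (i, e))%:P).[x]).
    by rewrite pair_bigA; apply: eq_bigr => -[i e] _.
  by apply: eq_bigr => i _; rewrite prod_F2 !hornerXsubC.
rewrite !ev mulrACA -big_split /= exprMn mulrCA -expr2; congr (_ * _).
have -> : (-1) ^+ n = \prod_(i < n) (-1 : L) by rewrite prodr_const card_ord.
rewrite /pair_delta -prodrXl -big_split /=; apply: eq_bigr => i _.
have := r01 i; set x := r (i, 0); set y := r (i, 1) => xy.
transitivity ((1 - x ^+ 2) * (1 - y ^+ 2)); first by ring.
transitivity (1 - x ^+ 2 - y ^+ 2 + (x * y) ^+ 2); first by ring.
transitivity (- 1 * (x ^+ 2 - 2 * (x * y) + y ^+ 2)); last by ring.
by rewrite xy; ring.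
Qed.

(** Permuting the pairs only reorders the factors, and each swap inside a pair reverses one sign. *)
Lemma gal_pair_delta (t : gal_of {:L}) (v : 'rV['F_2]_n) (s : 'S_n) :
  (forall k, t (r k) = r (wreath_perm v s k)) ->
  t pair_delta = if \sum_i v 0 i == 0 then pair_delta else - pair_delta.
Proof.
move=> tr; rewrite /pair_delta rmorph_prod.
transitivity (\prod_i ((-1) ^+ (v 0 i : nat) * (r (s i, 0) - r (s i, 1)))).
  apply: eq_bigr => i _; rewrite rmorphB /= !tr !permE /wreath_fun /= add0r.
  case: (F2_cases (v 0 i)) => ->; first by rewrite addr0 expr0 mul1r.
  have -> : 1 + 1 = 0 :> 'F_2 by apply: val_inj.
  by rewrite expr1 mulN1r opprB.
have rE : \prod_i (r (i, 0) - r (i, 1)) = \prod_i (r (s i, 0) - r (s i, 1)).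
  by rewrite [LHS](reindex_inj (@perm_inj _ s)).
rewrite big_split /= -rE.
have -> : \prod_i (-1) ^+ (v 0 i : nat) = (-1) ^+ (\sum_i v 0 i != 0) :> L.
  have nat0 m : (m%:R == 0 :> 'F_2) = ~~ odd m.
    by rewrite -(dvdn_pcharf (pchar_Fp (isT : prime 2))) dvdn2.
  rewrite prodrXr -signr_odd; congr (_ ^+ nat_of_bool _).
  rewrite -[odd _]negbK -nat0; congr (~~ (_ == 0)).
  by rewrite natr_sum; apply: eq_bigr => i _; rewrite natr_Zp.
by case: eqP => _; rewrite ?expr0 ?expr1 ?mul1r ?mulN1r.
Qed.

(** Automorphisms commute with inversion, so [s] is determined by the images of the labels [(i, 0)]:
    their first components form [u] and their second components form [v]. *)
Lemma galperm_wreath (s : {perm 'I_n * 'F_2}) : s \in galperm r ->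
  exists (v : 'rV['F_2]_n) (u : 'S_n), s = wreath_perm v u.
Proof.
case/galpermP => t tG ts.
have r0 k : r k != 0.
  case: k => i e; apply/eqP => re; have := r01 i.
  by case: (F2_cases e) re => -> ->; rewrite ?mul0r ?mulr0 => /eqP; rewrite eq_sym oner_eq0.
have rV i e : r (i, e + 1) = (r (i, e))^-1.
  have inv x y : x * y = 1 -> y = x^-1 :> L.
    move=> xy; have x0 : x != 0 by apply: contra_eq_neq xy => ->; rewrite mul0r eq_sym oner_eq0.
    by apply: (mulfI x0); rewrite xy mulfV.
  case: (F2_cases e) => ->; first by rewrite add0r; apply: inv.
  have -> : 1 + 1 = 0 :> 'F_2 by apply: val_inj.
  by apply: inv; rewrite mulrC.
have s1 i : s (i, 1) = ((s (i, 0)).1, (s (i, 0)).2 + 1).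
  apply: rf.1; rewrite rV -surjective_pairing -!ts -fmorphV -rV add0r.
  by [].
have sE i e : s (i, e) = ((s (i, 0)).1, e + (s (i, 0)).2).
  by case: (F2_cases e) => ->; rewrite ?add0r -?surjective_pairing// s1 addrC.
have uI : injective (fun i => (s (i, 0)).1).
  move=> i j e; have : s (j, (s (i, 0)).2 - (s (j, 0)).2) = s (i, 0).
    by rewrite sE subrK -e -surjective_pairing.
  by move/perm_inj => [].
exists (\row_i (s (i, 0)).2), (perm uI); apply/permP => -[i e].
by rewrite !permE /wreath_fun /= mxE permE sE.
Qed.

End PairedRoots.

Lemma rat_sqr_int (q : rat) (m : int) : q ^+ 2 = m%:~R -> exists k : int, q = k%:~R.
Proof.
move=> qm; have : (ratr q : algC) \in Num.int.
  apply: Cint_rat_Aint; first by apply/CratP; exists q.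
  apply: (@root_monic_Aint ('X^2 - (m%:~R)%:P)).
  - by rewrite /root !hornerE -rmorphXn qm rmorph_int subrr.
  - exact: monicXnsubC.
  - apply/polyOverP => i; rewrite coefB coefXn coefC pmulrn.
    by case: ifP => _; rewrite ?subr0 -?intrB rpred_int.
case/intrP => k kE; exists k; apply: (fmorph_inj (ratr : {rmorphism rat -> algC})).
by rewrite rmorph_int.
Qed.

Lemma evalZ_int (K : nzRingType) (f : {poly int}) (c : int) :
  evalZ f (c%:~R : K) = (f.[c])%:~R.
Proof. by rewrite /evalZ -(horner_map (intr : {rmorphism int -> K})). Qed.

(** Inside [G1] every automorphism fixes [pair_delta], which is thus rational. Its product with the
    leading coefficient has an integral square, so it is an integer [m]; it is nonzero because the
    roots are distinct. *)
Lemma sub_G1_square (n : nat) (f : {poly int}) : size f = (2 * n).+1 ->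
  galois_group_sub f (G1 n) ->
  exists2 m : int, m != 0 & f.[1] * f.[-1] = (-1) ^+ n * m ^+ 2.
Proof.
move=> szf [L [r [_ [rf r01] sub]]].
have [q qE] : exists q : rat, pair_delta r = ratr q.
  apply: gal_rat_fixed => t tG; have [s sr ts] := galperm_lift rf tG.
  have /imset2P[v u + _ sE] := fintype.subsetP sub _ sr.
  rewrite finset.inE => /eqP v0; rewrite sE in ts.
  by rewrite (gal_pair_delta ts) v0 eqxx.
have d0 := pair_delta_neq0 rf.
have a0 : lead_coef f != 0 by rewrite lead_coef_eq0 -size_poly_eq0 szf.
have ev := evalZ_pm1_pair_delta rf r01 szf.
have : ((lead_coef f)%:~R * q) ^+ 2 = ((-1) ^+ n * (f.[1] * f.[-1]))%:~R.
  apply: (fmorph_inj (in_alg L)); rewrite [RHS]rmorph_int.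
  transitivity (((lead_coef f)%:~R * pair_delta r) ^+ 2).
    rewrite rmorphXn rmorphM rmorph_int; congr ((_ * _) ^+ 2).
    by rewrite qE; exact: alg_num_field.
  transitivity ((-1) ^+ n * (evalZ f (1 : L) * evalZ f (-1))).
    by rewrite ev mulrA -expr2 sqrr_sign mul1r.
  by rewrite -[1](rmorph1 intr) -rmorphN /= !evalZ_int !intrM rmorphXn.
move=> sq; have [m mE] := rat_sqr_int sq; exists m.
  apply: contra_neq d0 => m0; rewrite qE.
  move/eqP: mE; rewrite m0 mulf_eq0 intr_eq0 (negPf a0) => /eqP ->.
  by rewrite -alg_num_field scale0r.
move: sq; rewrite mE -rmorphXn => /intr_inj ->.
by rewrite mulrA -expr2 sqrr_sign mul1r.
Qed.

(** The leading coefficient times [pair_delta] equals [m] or [- m], so it is fixed by all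
    automorphisms. An element outside [G1] would change its sign, although it is nonzero. *)
Lemma square_sub_G1 (n : nat) (f : {poly int}) (z : 'I_n * 'F_2 -> algC) (m : int) :
  size f = (2 * n).+1 -> injective z ->
  map_poly intr f = (lead_coef f)%:~R *: \prod_k ('X - (z k)%:P) :> {poly algC} ->
  (forall i, z (i, 0) * z (i, 1) = 1) ->
  f.[1] * f.[-1] = (-1) ^+ n * m ^+ 2 -> galois_group_sub f (G1 n).
Proof.
move=> szf zI fz z01 fm.
have a0 : lead_coef f != 0 by rewrite lead_coef_eq0 -size_poly_eq0 szf.
have [L [iota [r [fL rf fr rz]]]] := splitting_field_in_C a0 zI fz.
have r01 i : r (i, 0) * r (i, 1) = 1.
  by apply: (fmorph_inj iota); rewrite rmorphM rmorph1 !rz.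
exists L, r; split=> //; apply/fintype.subsetP => s sr.
have [v [u sE]] := galperm_wreath rf r01 sr.
apply/imset2P; exists v u => //; rewrite ?finset.in_setT// finset.inE.
apply: contraT => vn; case/galpermP: sr => t tG ts; rewrite sE in ts.
have td : t (pair_delta r) = - pair_delta r by rewrite (gal_pair_delta ts) ifN.
have := evalZ_pm1_pair_delta rf r01 szf.
have -> : evalZ f (1 : L) = (f.[1])%:~R by rewrite -evalZ_int.
have -> : evalZ f (-1 : L) = (f.[-1])%:~R by rewrite -evalZ_int rmorphN1.
have fmL : (f.[1])%:~R * (f.[-1])%:~R = (-1) ^+ n * m%:~R ^+ 2 :> L.
  by rewrite -intrM fm rmorphM !rmorphXn rmorphN1.
rewrite fmL.
have sn : (-1) ^+ n != 0 :> L by rewrite signr_eq0.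
move/(mulfI sn) => /eqP.
rewrite eqf_sqr => ad; have d0 := pair_delta_neq0 rf.
have [k kE] : exists k : int, (lead_coef f)%:~R * pair_delta r = k%:~R.
  by case/orP: ad => /eqP e; [exists m | exists (- m); rewrite mulrNz e opprK].
have tk : t ((lead_coef f)%:~R * pair_delta r) = (lead_coef f)%:~R * t (pair_delta r).
  by rewrite rmorphM rmorph_int.
move: tk; rewrite td mulrN kE rmorph_int => /eqP.
rewrite -addr_eq0 -intrD intr_rat_ext_eq0 => /eqP kk; have {kk} k0 : k = 0 by lia.
by move: d0; have /eqP := kE; rewrite k0 mulf_eq0 intr_rat_ext_eq0 (negPf a0) /= => ->.
Qed.

Lemma horner_square_family (Q : {poly int}) (d u v : int) :
  (square_family Q d u v).[2] = 4 * d * u ^+ 2 /\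
  (square_family Q d u v).[-2] = 4 * d * v ^+ 2.
Proof. have e x : (square_family Q d u v).[x] =
    (x ^+ 2 - 4) * Q.[x] + d * (u ^+ 2 - v ^+ 2) * x + 2 * d * (u ^+ 2 + v ^+ 2).
  by rewrite /square_family hornerD hornerC hornerD hornerZ hornerX hornerM hornerD hornerN hornerC hornerXn.
by split; rewrite e; ring. Qed.

Lemma horner_reciprocal_lift_pm1 (n : nat) (g : {poly int}) : (size g <= n.+1)%N ->
  (reciprocal_lift n g).[1] = g.[2] /\
  (reciprocal_lift n g).[-1] = (-1) ^+ n * g.[-2].
Proof.
move=> sg; split; apply: (@intr_inj rat).
  rewrite -!evalZ_int rmorph1 evalZ_reciprocal_lift ?oner_neq0//.
  by rewrite expr1n mul1r invr1.
by rewrite rmorphM rmorphXn /= -!evalZ_int !rmorphN1 evalZ_reciprocal_lift ?oppr_eq0 ?oner_neq0//.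
Qed.

Lemma Eset_square_family (R : realType) (n : nat) (Q : {poly int}) (d u v : int) (H : R) :
  let g := square_family Q d u v in let f := reciprocal_lift n g in
  size g = n.+1 -> separableZ g -> galois_group_is_Sn n g ->
  d != 0 -> u != 0 -> v != 0 -> (forall i, `|(f`_i)%:~R| <= H) ->
  Eset (G1 n) H f.
Proof.
move=> g f szg sepg Sng d0 u0 v0 fH.
have g0 : g != 0 by rewrite -size_poly_eq0 szg.
have szg' : (size g <= n.+1)%N by rewrite szg.
have [szf _] := size_reciprocal_lift g0 szg'.
have {}szf : size f = (2 * n).+1 by rewrite szf szg; lia.
have [f1 fm1] := horner_reciprocal_lift_pm1 szg'.
have [g2 gm2] := horner_square_family Q d u v.
have [zg zgI gz] := separable_roots_in_C szg sepg.
have gzk k : evalZ g (zg k) = 0.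
  rewrite /evalZ gz hornerZ horner_prod (bigD1 k)//= hornerXsubC subrr mul0r mulr0.
  by [].
have w_ex k : exists w : algC, w != 0 /\ w + w^-1 = zg k.
  have [w] : exists w, root ('X^2 - zg k *: 'X + 1) w.
    apply/closed_rootP; rewrite -addrA size_polyDl size_polyXn//.
    rewrite (leq_ltn_trans (size_polyD _ _))// size_polyN size_poly1 gtn_max andbT.
    by rewrite (leq_ltn_trans (size_scale_leq _ _))// size_polyX.
  rewrite /root !hornerE => /eqP wE.
  have w0 : w != 0.
    apply: contra_eq_neq wE => ->; rewrite mulr0 expr0n subr0 add0r.
    exact: oner_neq0.
  exists w; split=> //; apply: (mulfI w0); rewrite mulrDr mulfV//.
  by apply/eqP; rewrite -subr_eq0 -wE; apply/eqP; ring.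
have [w wP] := boolp.choice w_ex.
pose z (k : 'I_n * 'F_2) : algC := if k.2 == 0 then w k.1 else (w k.1)^-1.
have z0 k : z k != 0 by have [e _] := wP k.1; rewrite /z; case: (k.2 == 0); rewrite ?invr_eq0.
have zE k : z k + (z k)^-1 = zg k.1.
  have [_ e] := wP k.1; rewrite /z; case: (k.2 == 0); first exact: e.
  by rewrite invrK addrC; exact: e.
(* Equality would mean $w = \pm 1$, making 2 or -2 a root of [g]; but the values there, $4du^2$ and
   $4dv^2$, are nonzero. This yields the separability of [f]. *)
have ww k : w k != (w k)^-1.
  have [wk0 wkE] := wP k; apply/eqP => e.
  have : (w k - 1) * (w k + 1) = 0.
    by rewrite -subr_sqr expr1n expr2 {2}e mulfV// subrr.
  move/eqP; rewrite mulf_eq0 subr_eq0 addr_eq0 => /orP[]/eqP wk.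
    have : (g.[2])%:~R = 0 :> algC.
      by rewrite -evalZ_int -(gzk k) -wkE wk invr1.
    by move/eqP; rewrite intr_eq0 g2 !mulf_eq0 ?sqrf_eq0 (negPf d0) (negPf u0).
  have : (g.[-2])%:~R = 0 :> algC.
    by rewrite -evalZ_int -(gzk k) -wkE wk invrN1 -opprD rmorphN.
  by move/eqP; rewrite intr_eq0 gm2 !mulf_eq0 ?sqrf_eq0 (negPf d0) (negPf v0).
have zI : injective z.
  move=> [i a] [j b] e; have ij : i = j by apply: zgI; rewrite -(zE (i, a)) -(zE (j, b)) e.
  rewrite -ij in e *; congr (_, _); move: e; rewrite /z /=.
  by case: (F2_cases a) (F2_cases b) => -> [] -> //= /eqP; rewrite ?(negPf (ww i))// eq_sym (negPf (ww i)).
have card2 : #|{: 'I_n * 'F_2}| = (2 * n)%N by rewrite card_prod card_ord card_Fp// mulnC.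
have fz : map_poly intr f = (lead_coef f)%:~R *: \prod_k ('X - (z k)%:P) :> {poly algC}.
  apply: factored_of_roots => //; first exact: intr_inj.
    by move=> k; rewrite evalZ_reciprocal_lift// zE gzk mulr0.
  by rewrite szf card2.
split=> //.
- exact: reciprocal_reciprocal_lift.
- rewrite /separableZ -(separable_map (ratr : {rmorphism rat -> algC})) map_poly_rmorph_intr fz.
  have l0 : (lead_coef f)%:~R != 0 :> algC by rewrite intr_eq0 lead_coef_eq0 -size_poly_eq0 szf.
  rewrite (eqp_separable (eqp_scale _ l0)).
  have -> : \prod_k ('X - (z k)%:P) = \prod_(x <- codom z) ('X - x%:P) by rewrite big_image.
  by rewrite separable_prod_XsubC map_inj_uniq ?enum_uniq.
- split; first by exists g => //; exact: trace_poly_reciprocal_lift.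
  apply: (@square_sub_G1 n f z (4 * d * u * v)) => //.
    by move=> i; rewrite /z /= mulfV ?(wP i).1.
  by rewrite f1 fm1 g2 gm2; ring.
Qed.

Lemma evalZ_coef_wide (K : fieldType) (m : nat) (p : {poly int}) (y : K) :
  (size p <= m)%N -> evalZ p y = \sum_(i < m) (p`_i)%:~R * y ^+ i.
Proof.
move=> sp; rewrite /evalZ (horner_coef_wide _ (leq_trans (size_poly _ _) sp)).
by apply: eq_bigr => i _; rewrite coef_map.
Qed.

Lemma evalZ_xF (p : {poly int}) : evalZ p xF = tofrac p.
Proof.
rewrite /evalZ -{2}(coefK p) poly_def rmorph_sum horner_poly.
apply: eq_bigr => i _; rewrite -mul_polyC rmorphM rmorphXn; congr (_ * _).
have -> (c : int) : c%:P = c%:~R :> {poly int}.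
  by rewrite -{1}[c]intz; exact: rmorph_int.
by rewrite [RHS]rmorph_int.
Qed.

Lemma reciprocal_coef (n : nat) (f : {poly int}) : size f = (2 * n).+1 ->
  reciprocal n f -> forall i, (i <= 2 * n)%N -> f`_(2 * n - i) = f`_i.
Proof.
move=> szf; rewrite /reciprocal evalZ_xF.
have -> : xF ^+ (2 * n) * evalZ f xF^-1 = tofrac (\poly_(i < (2 * n).+1) f`_(2 * n - i)).
  rewrite -evalZ_xF (evalZ_coef_wide _ (leqnn _)) szf mulr_sumr.
  rewrite (evalZ_coef_wide _ (size_poly _ _)) [RHS](reindex_inj rev_ord_inj) /=.
  apply: eq_bigr => i _; have ilt := ltn_ord i.
  rewrite coef_poly subSS ltnS leq_subr subKn; last by rewrite -ltnS.
  rewrite mulrCA; congr (_ * _); rewrite exprVn.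
  have e : (2 * n = (2 * n - i) + i)%N by lia.
  by rewrite {1}e exprD mulfK// expf_neq0// xF_neq0.
move=> /eqP; rewrite tofrac_eq => /eqP e i ile.
have := congr1 (fun p : {poly int} => p`_i) e.
by rewrite coef_poly ltnS ile.
Qed.

(** * Upper bound *)

(** By symmetry the difference is $h_m(X^m + X^{m+2}) + h_{m+1}X^{m+1}$. Its values at $\pm 1$
    vanish, which gives $2h_m + h_{m+1} = 0$ and $2h_m - h_{m+1} = 0$. *)
Lemma reciprocal_determined (m : nat) (f f' : {poly int}) :
  size f = (2 * m.+1).+1 -> size f' = (2 * m.+1).+1 ->
  reciprocal m.+1 f -> reciprocal m.+1 f' ->
  (forall i, (i < m)%N -> f`_i = f'`_i) -> f.[1] = f'.[1] -> f.[-1] = f'.[-1] -> f = f'.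
Proof.
move=> sf sf' rf rf' fi f1 fm1; have [h hd] : exists h, h = f - f' by exists (f - f').
have hsym i : (i <= 2 * m.+1)%N -> h`_(2 * m.+1 - i) = h`_i.
  by move=> ile; rewrite hd !coefB (reciprocal_coef sf rf)// (reciprocal_coef sf' rf').
have hlow i : (i < m)%N -> h`_i = 0 by move=> im; rewrite hd coefB fi// subrr.
have hE : h = h`_m *: ('X^m + 'X^(m.+2)) + h`_(m.+1) *: 'X^(m.+1).
  apply/polyP => i; rewrite coefD !coefZ coefD !coefXn.
  have F (j k : nat) : j <> k -> (j == k) = false by move=> /eqP/negPf.
  have [im|mi] := ltnP i m.
    by rewrite hlow// !F ?(mulr0, addr0)//; lia.
  have [->|im] := eqVneq i m.
    by rewrite ?eqxx ?(F m m.+2) ?(F m m.+1) ?(mulr0, addr0, mulr1)//; lia.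
  have [->|im1] := eqVneq i m.+1.
    by rewrite ?eqxx ?(F m.+1 m) ?(F m.+1 m.+2) ?(mulr0, addr0, add0r, mulr1)//; lia.
  have [->|im2] := eqVneq i m.+2.
    rewrite ?eqxx ?(F m.+2 m) ?(F m.+2 m.+1) ?(mulr0, addr0, add0r, mulr1); try by lia.
    by rewrite -(hsym m); [congr (h`_ _); lia | lia].
  rewrite ?(negPf im) ?(negPf im1) ?(negPf im2) ?(mulr0, addr0).
  have [ile|igt] := leqP i (2 * m.+1); first by rewrite -hsym// hlow//; lia.
  rewrite nth_default//; apply: leq_trans igt.
  by rewrite hd (leq_trans (size_polyD _ _))// size_polyN sf sf' maxnn.
have h1 : h.[1] = 0 by rewrite hd hornerD hornerN f1 subrr.
have hm1 : h.[-1] = 0 by rewrite hd hornerD hornerN fm1 subrr.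
have ev x : h.[x] = h`_m * (x ^+ m + x ^+ m.+2) + h`_m.+1 * x ^+ m.+1.
  by rewrite {1}hE hornerD !hornerZ hornerD !hornerXn.
have e1 : h`_m * 2 + h`_m.+1 = 0 by rewrite -[RHS]h1 ev !expr1n; ring.
have e2 : h`_m * 2 - h`_m.+1 = 0.
  have s0 : (-1) ^+ m != 0 :> int by rewrite signr_eq0.
  by apply: (mulfI s0); rewrite mulr0 -[RHS]hm1 ev !exprS; ring.
have hm0 : h`_m = 0 by lia.
have hm10 : h`_m.+1 = 0 by lia.
by apply/eqP; rewrite -subr_eq0 -hd {1}hE hm0 hm10 !scale0r addr0.
Qed.

Lemma absz_horner_sign (f : {poly int}) (n N : nat) (e : int) : absz e = 1%N ->
  (size f <= n)%N -> (forall i, absz (f`_i)%R <= N)%N -> (absz f.[e] <= n * N)%N.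
Proof.
move=> e1 sf fN; rewrite (horner_coef_wide _ sf).
apply: leq_trans (leq_absz_sum _) _; rewrite -[n in (n * N)%N]card_ord -sum_nat_const.
by apply: leq_sum => i _; rewrite abszM abszX e1 exp1n muln1.
Qed.

(** $\gcd(a,m)^2 = \gcd(a^2, m^2) = \gcd(a^2, ab) = a\gcd(a,b) = a$. *)
Lemma coprime_square (a b m : nat) : (0 < m)%N -> coprime a b -> (a * b = m ^ 2)%N ->
  a = (gcdn a m ^ 2)%N.
Proof.
move=> m0 cab abm; have a0 : (0 < a)%N by move: abm m0; case: a {cab} => // ; lia.
set s := gcdn a m; have s0 : (0 < s)%N by rewrite gcdn_gt0 a0.
have /dvdnP[a1 aE] : (s %| a)%N := dvdn_gcdl _ _.
have /dvdnP[m1 mE] : (s %| m)%N := dvdn_gcdr _ _.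
have c1 : coprime a1 m1.
  rewrite /coprime -(eqn_pmul2r s0) mul1n muln_gcdl -aE -mE.
  by [].
have : gcdn (a ^ 2) (m ^ 2) = (s ^ 2)%N.
  rewrite aE mE !expnMn -muln_gcdl.
  have /eqP -> : coprime (a1 ^ 2) (m1 ^ 2) by apply/coprimeXl/coprimeXr.
  by rewrite mul1n.
by rewrite -abm -mulnn -muln_gcdr (eqP cab) muln1.
Qed.

(** With $d = \gcd(a,b)$, the quotients $a/d$ and $b/d$ are coprime with square product, so each is
    a square. *)
Lemma square_product_split (a b m : nat) : (0 < m)%N -> (a * b = m ^ 2)%N ->
  exists d s t, [/\ (0 < d)%N, a = (d * s ^ 2)%N & b = (d * t ^ 2)%N].
Proof.
move=> m0 abm.
have ab0 : (0 < a * b)%N by rewrite abm expn_gt0 m0.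
move: ab0; rewrite muln_gt0 => /andP[a0 b0].
set d := gcdn a b; have d0 : (0 < d)%N by rewrite gcdn_gt0 a0.
have /dvdnP[a1 aE] : (d %| a)%N := dvdn_gcdl _ _.
have /dvdnP[b1 bE] : (d %| b)%N := dvdn_gcdr _ _.
have c1 : coprime a1 b1.
  rewrite /coprime -(eqn_pmul2r d0) mul1n muln_gcdl -aE -bE.
  by [].
have dm : (d ^ 2 %| m ^ 2)%N by rewrite -abm aE bE; apply/dvdnP; exists (a1 * b1)%N; lia.
move: dm; rewrite dvdn_pexp2r// => /dvdnP[m1 mE].
have m10 : (0 < m1)%N by move: m0; rewrite mE; case: m1 {mE}.
have abm1 : (a1 * b1 = m1 ^ 2)%N.
  have : (a1 * b1 * d ^ 2 = m1 ^ 2 * d ^ 2)%N by rewrite -expnMn -mE -abm aE bE; lia.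
  by move/eqP; rewrite eqn_pmul2r ?expn_gt0 ?d0// => /eqP.
exists d, (gcdn a1 m1), (gcdn b1 m1); split=> //.
  by rewrite {1}aE mulnC -(coprime_square m10 c1 abm1).
by rewrite {1}bE mulnC -(@coprime_square b1 a1 m1)// 1?coprime_sym// mulnC.
Qed.

(** Triples $(d,s,t)$ encoding $|f(1)| = ds^2$ and $|f(-1)| = dt^2$. A pair of values may have
    several encodings; for an upper bound one suffices. *)
Definition square_triples (X : nat) : {set 'I_X.+1 * ('I_X.+1 * 'I_X.+1)} :=
  [set x : 'I_X.+1 * ('I_X.+1 * 'I_X.+1) | [&& (0 < x.1)%N, (0 < x.2.1)%N, (0 < x.2.2)%N,
     (x.1 * x.2.1 ^ 2 <= X)%N & (x.1 * x.2.2 ^ 2 <= X)%N]]%SET.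

Lemma card_square_triples (X : nat) :
  (#|square_triples X| <= \sum_(1 <= d < X.+1) X %/ d)%N.
Proof.
pose S (d : nat) := [set s : 'I_X.+1 | (0 < s)%N && (d * s ^ 2 <= X)%N]%SET.
(* Since [S d] consists of positive integers, if nonempty it has an element that is at least
   [#|S d|], and membership of that element bounds [d * #|S d| ^ 2] by [X]. *)
have Sd d : (0 < d)%N -> (#|S d| ^ 2 <= X %/ d)%N.
  move=> d0; rewrite leq_divRL// mulnC.
  have [->|[s0 s0S]] := finset.set_0Vmem (S d); first by rewrite cards0 muln0.
  suff [s sS le] : exists2 s, s \in S d & (#|S d| <= s)%N.
    move: sS; rewrite finset.inE => /andP[_]; apply: leq_trans.
    by rewrite leq_mul2l leq_exp2r// le orbT.
  apply: contrapT => nex.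
  have lt s : s \in S d -> (s < #|S d|)%N.
    by move=> sS; rewrite ltnNge; apply/negP => le; apply: nex; exists s.
  have : (size [seq nat_of_ord s | s <- enum (S d)] <= size (iota 1 #|S d|.-1))%N.
    apply: uniq_leq_size; first by rewrite map_inj_uniq ?enum_uniq//; exact: ord_inj.
    move=> _ /mapP[s + ->]; rewrite mem_enum mem_iota => sS.
    have slt := lt _ sS; move: sS; rewrite finset.inE => /andP[sp _].
    by rewrite sp add1n prednK//; exact: leq_ltn_trans slt.
  rewrite size_map -cardE size_iota; have := lt _ s0S; lia.
have -> : #|square_triples X| = (\sum_(d : 'I_X.+1 | 0 < d) #|finset.setX (S d) (S d)|)%N.
  rewrite -sum1_card.
  transitivity (\sum_(d : 'I_X.+1 | (0 < d)%N) \sum_(y in finset.setX (S d) (S d)) 1)%N; last first.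
    by apply: eq_bigr => d _; rewrite sum1_card.
  rewrite pair_big_dep /=; apply: eq_bigl => -[d [s t]] /=.
  rewrite !finset.inE /=; case: (0 < d)%N => //=; case: (0 < s)%N => //=.
  by rewrite andbA [(0 < t)%N && _]andbC -andbA [(0 < t)%N && _]andbC.
rewrite big_mkcond big_ord_recl /= add0n big_add1 /= big_mkord.
by apply: leq_sum => d _; rewrite finset.cardsX mulnn Sd.
Qed.

Lemma card_fset_set_le (T : finType) (U : choiceType) (S : set U) (A : {set T}) (P : U -> T -> Prop) :
  finite_set S -> (forall f, S f -> exists2 x, x \in A & P f x) ->
  (forall f f' x, S f -> S f' -> P f x -> P f' x -> f = f') ->
  (#|` fset_set S|%fset <= #|A|)%N.
Proof.
move=> Sfin SP Pinj.
have ex (f : U) : exists x : option T, S f -> exists2 y, x = Some y & y \in A /\ P f y.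
  have [Sf|nS] := pselect (S f); last by exists None.
  by have [x xA Px] := SP f Sf; exists (Some x) => _; exists x.
have [h hP] := boolp.choice ex.
have memS f : f \in enum_fset (fset_set S) -> S f.
  by rewrite (_ : (f \in _) = (f \in fset_set S))// in_fset_set// => /set_mem.
have hU : uniq [seq h f | f <- enum_fset (fset_set S)].
  rewrite map_inj_in_uniq ?fset_uniq// => f f' /memS Sf /memS Sf' e.
  have [y hy [_ Py]] := hP f Sf; have [y' hy' [_ Py']] := hP f' Sf'.
  have yy : y = y' by move: e; rewrite hy hy' => -[].
  by rewrite -yy in Py'; exact: Pinj Py Py'.
have -> : #|` fset_set S|%fset = size [seq h f | f <- enum_fset (fset_set S)].
  by rewrite size_map.
rewrite cardE -(size_map (@Some T)); apply: uniq_leq_size => //.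
move=> _ /mapP[f /memS Sf ->]; have [y -> [yA _]] := hP f Sf.
by rewrite map_f// mem_enum.
Qed.

Lemma card_fset_set_ge (T : finType) (U : choiceType) (S : set U) (A : {set T}) (h : T -> U) :
  finite_set S -> (forall x, x \in A -> S (h x)) -> {in A &, injective h} ->
  (#|A| <= #|` fset_set S|%fset)%N.
Proof.
move=> Sfin hS hI; rewrite cardE -(size_map h).
apply: (@uniq_leq_size _ _ (enum_fset (fset_set S))).
  by rewrite map_inj_in_uniq ?enum_uniq// => x y; rewrite !mem_enum; exact: hI.
move=> _ /mapP[x + ->]; rewrite mem_enum => xA.
by rewrite (_ : (_ \in _) = (h x \in fset_set S))// in_fset_set// mem_set//; exact: hS.
Qed.

(** The lowest [l] coefficients are constant on [S] and the next [k] are free; [l] is 0 in the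
    general count and 1 in the monic one. The factor 4 records the signs of $f(1)$ and $f(-1)$,
    whose sizes are at most $(2n+1)N$. *)
Lemma upper_count (n l k N : nat) (S : set {poly int}) :
  (0 < n)%N -> (l + k = n.-1)%N -> finite_set S ->
  (forall f, S f -> [/\ size f = (2 * n).+1, reciprocal n f, galois_group_sub f (G1 n)
     & forall i, (absz (f`_i)%R <= N)%N]) ->
  (forall f f' i, S f -> S f' -> (i < l)%N -> f`_i = f'`_i) ->
  (#|` fset_set S|%fset <=
   (2 * N).+1 ^ k * (4 * #|square_triples ((2 * n).+1 * N)|))%N.
Proof.
case: n => // m _ /= lk Sfin SP Sl; set X := ((2 * m.+1).+1 * N)%N.
pose T := ({ffun 'I_k -> 'I_(2 * N).+1} * ((bool * bool) * ('I_X.+1 * ('I_X.+1 * 'I_X.+1))))%type.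
pose A : {set T} := [set x | x.2.2 \in square_triples X]%SET.
have cardA : #|A| = ((2 * N).+1 ^ k * (4 * #|square_triples X|))%N.
  have -> : A = finset.setX [set: {ffun 'I_k -> 'I_(2 * N).+1}]%SET
              (finset.setX [set: bool * bool]%SET (square_triples X)).
    by apply/setP => -[a [b c]]; rewrite !finset.inE.
  by rewrite !finset.cardsX !cardsT card_ffun !card_ord card_prod !card_bool.
rewrite -cardA.
apply: (card_fset_set_le (P := fun (f : {poly int}) (x : T) =>
  [/\ forall i : 'I_k, f`_(l + i)%N + N%:Z = (x.1 i)%:Z,
      x.2.1 = (0 <= f.[1], 0 <= f.[-1]),
      absz f.[1] = (x.2.2.1 * x.2.2.2.1 ^ 2)%N
    & absz f.[-1] = (x.2.2.1 * x.2.2.2.2 ^ 2)%N])) => //.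
- move=> f /SP[szf rf subf fN].
  have [q q0 fq] := sub_G1_square szf subf.
  have abm : (absz f.[1] * absz f.[-1] = absz q ^ 2)%N.
    rewrite -abszM fq abszM !abszX (_ : (absz (-1)%R ^ m.+1 = 1)%N) ?mul1n//.
    exact: exp1n.
  have am0 : (0 < absz q)%N by rewrite absz_gt0.
  have [d [s [t [d0 e1 em1]]]] := square_product_split am0 abm.
  have ab0 : (0 < absz f.[1] * absz f.[-1])%N by rewrite abm expn_gt0 am0.
  move: ab0; rewrite muln_gt0 => /andP[f10 fm10].
  have b1 : (absz f.[1] <= X)%N by apply: absz_horner_sign => //; rewrite szf.
  have bm1 : (absz f.[-1] <= X)%N by apply: absz_horner_sign => //; rewrite szf.
  rewrite e1 in f10 b1; rewrite em1 in fm10 bm1.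
  have [s0 t0] : (0 < s)%N /\ (0 < t)%N.
    by split; rewrite lt0n; [apply: contraTneq f10 | apply: contraTneq fm10] => ->; rewrite muln0.
  have dX : (d <= X)%N by apply: leq_trans b1; rewrite leq_pmulr ?expn_gt0 ?s0.
  have sX : (s <= X)%N.
    by apply: leq_trans b1; apply: leq_trans (leq_pmull _ d0); rewrite -mulnn leq_pmulr.
  have tX : (t <= X)%N.
    by apply: leq_trans bm1; apply: leq_trans (leq_pmull _ d0); rewrite -mulnn leq_pmulr.
  have cN i : (absz (f`_i + N%:Z)%R < (2 * N).+1)%N.
    rewrite ltnS -lez_nat abszE (le_trans (ler_normD _ _))// mul2n -addnn PoszD.
    by rewrite lerD// -abszE lez_nat.
  exists ([ffun i : 'I_k => Ordinal (cN (l + i)%N)],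
     ((0 <= f.[1], 0 <= f.[-1]), (inord d, (inord s, inord t)))).
    by rewrite finset.inE /= finset.inE /= !inordK// d0 s0 t0 b1 bm1.
  split; rewrite //= ?inordK//.
  move=> i; have h := fN (l + i)%N; rewrite ffunE /= gez0_abs//.
  have /andP[fl _] : (- N%:Z <= f`_(l + i)%N <= N%:Z) by rewrite -ler_norml -abszE lez_nat.
  by rewrite -lerBlDr sub0r.
- move=> f f' x Sf Sf' [h1 h2 h3 h4] [h1' h2' h3' h4'].
  have [szf rf _ _] := SP f Sf; have [szf' rf' _ _] := SP f' Sf'.
  have [e1 em1] : (0 <= f.[1]) = (0 <= f'.[1]) /\ (0 <= f.[-1]) = (0 <= f'.[-1]).
    by move: h2'; rewrite h2 => -[].
  apply: reciprocal_determined szf szf' rf rf' _ _ _.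
  + move=> i im; have [il|li] := ltnP i l; first exact: Sl.
    have ik : (i - l < k)%N by lia.
    have := h1 (Ordinal ik); rewrite -(h1' (Ordinal ik)) /= subnKC//.
    by move/addIr.
  + by move: e1 h3; rewrite -h3'; lia.
  + by move: em1 h4; rewrite -h4'; lia.
Qed.

(** * Harmonic sums and the upper bound as a function of $H$ *)

Section Harmonic.
Variable R : realType.

Lemma harmonic_le_ln (X : nat) : (0 < X)%N ->
  \sum_(1 <= d < X.+1) (d%:R : R)^-1 <= 1 + ln X%:R.
Proof.
elim: X => // -[_ _|X IH _]; first by rewrite big_nat1 invr1 ln1 addr0.
rewrite big_nat_recr//=.
apply: le_trans (_ : 1 + ln X.+1%:R + (X.+2%:R)^-1 <= _); first by rewrite lerD2r IH.
rewrite -addrA lerD2l -lerBrDl -lerN2 opprB -ln_div ?posrE ?ltr0n//.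
have -> : X.+1%:R / X.+2%:R = 1 + - (X.+2%:R)^-1 :> R.
  have y0 : X.+2%:R != 0 :> R by rewrite pnatr_eq0.
  by apply: (mulIf y0); rewrite mulfVK// mulrDl mulNr mulVf// mul1r -(natr1 X.+1) addrK.
by apply: le_ln1Dx; rewrite ltrN2 invf_lt1 ?ltr1n ?ltr0n.
Qed.

Lemma ln_le_harmonic (X : nat) : ln X.+1%:R <= \sum_(1 <= d < X.+1) (d%:R : R)^-1.
Proof.
elim: X => [|X IH]; first by rewrite big_geq// ln1.
rewrite big_nat_recr//= -lerBlDl; apply: le_trans (_ : (X.+1%:R)^-1 <= _).
  apply: le_trans (_ : ln X.+2%:R - ln X.+1%:R <= _); first by rewrite lerB.
  rewrite -ln_div ?posrE ?ltr0n//.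
  have -> : X.+2%:R / X.+1%:R = 1 + (X.+1%:R)^-1 :> R.
    have y0 : X.+1%:R != 0 :> R by rewrite pnatr_eq0.
    by apply: (mulIf y0); rewrite mulfVK// mulrDl mulVf// mul1r -(natr1 X.+1) addrC.
  by apply: le_ln1Dx; rewrite (lt_trans (ltrN10 R))// invr_gt0 ltr0n.
by [].
Qed.

Lemma card_square_triples_le_ln (X : nat) : (0 < X)%N ->
  (#|square_triples X|%:R : R) <= X%:R * (1 + ln X%:R).
Proof.
move=> X0; apply: le_trans (_ : X%:R * \sum_(1 <= d < X.+1) (d%:R : R)^-1 <= _); last first.
  by rewrite ler_wpM2l ?ler0n// harmonic_le_ln.
apply: le_trans (_ : (\sum_(1 <= d < X.+1) X %/ d)%:R <= _).
  by rewrite ler_nat card_square_triples.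
rewrite natr_sum mulr_sumr big_nat [in leRHS]big_nat; apply: ler_sum => d /andP[d0 _].
by rewrite ler_pdivlMr ?ltr0n// -natrM ler_nat leq_trunc_div.
Qed.

Lemma upper_asymptotic (n l k : nat) (S : R -> set {poly int}) :
  (0 < n)%N -> (l + k = n.-1)%N -> (forall H, finite_set (S H)) ->
  (forall H f, S H f -> [/\ size f = (2 * n).+1, reciprocal n f, galois_group_sub f (G1 n)
     & forall i, `|(f`_i)%:~R| <= H]) ->
  (forall H f f' i, S H f -> S H f' -> (i < l)%N -> f`_i = f'`_i) ->
  exists2 c : R, 0 < c & forall H, expR 1 <= H ->
    (#|` fset_set (S H)|%fset)%:R <= c * (H ^+ k.+1 * ln H).
Proof.
move=> n0 lk Sfin SP Sl; pose b : R := (2 * n).+1%:R.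
have b1 : 1 <= b by rewrite ler1n.
have b0 : 0 < b by rewrite ltr0n.
have lnb : 0 <= ln b by exact: ln_ge0.
(* The 3 comes from $2N + 1 \le 3H$. The last factor absorbs $1 + \ln b + \ln H$ into a multiple of
   $\ln H$, which is at least 1 because $H \ge e$. *)
exists (3 ^+ k * (4 * b * (2 + ln b))).
  have l2 : 0 < 2 + ln b by rewrite ltr_wpDr.
  by rewrite mulr_gt0 ?exprn_gt0// mulr_gt0// mulr_gt0.
move=> H He; have H1 : 1 <= H.
  by apply: le_trans He; rewrite -[X in X <= _]expR0 ler_expR.
have H0 : 0 < H by rewrite (lt_le_trans _ H1).
have lnH : 1 <= ln H by rewrite -[X in X <= _]expRK ler_ln ?posrE ?expR_gt0.
pose N := Num.truncn H.
have NH : N%:R <= H by rewrite truncn_le// ltW.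
have N0 : (0 < N)%N by rewrite truncn_gt0.
have cnt := @upper_count n l k N (S H) n0 lk (Sfin H) _ (Sl H).
apply: le_trans (_ : ((2 * N).+1 ^ k * (4 * #|square_triples ((2 * n).+1 * N)|))%:R <= _).
  rewrite ler_nat; apply: cnt => f /SP[szf rf sf fH]; split=> // i.
  rewrite truncn_ge_nat; last exact: ltW.
  apply: le_trans (fH i).
  by rewrite -intr_norm pmulrn abszE.
set X := ((2 * n).+1 * N)%N.
have X0 : (0 < X)%N by rewrite muln_gt0.
have XH : X%:R <= b * H by rewrite natrM ler_wpM2l// ltW.
rewrite natrM natrX [in leRHS]exprS.
apply: le_trans (_ : (3 * H) ^+ k * (4 * (b * H * ((2 + ln b) * ln H))) <= _); last first.
  by rewrite exprMn le_eqVlt; apply/orP; left; apply/eqP; ring.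
apply: ler_pM => //.
  have H0' := ltW H0; apply: lerXn2r; rewrite ?nnegrE ?ler0n ?mulr_ge0//.
  have -> : (2 * N).+1%:R = 2 * N%:R + 1 :> R by rewrite -natr1 natrM.
  by lra.
rewrite natrM ler_wpM2l//.
apply: le_trans (card_square_triples_le_ln X0) _.
apply: ler_pM => //; first by rewrite addr_ge0// ln_ge0// ler1n.
have : ln X%:R <= ln b + ln H.
  by rewrite -lnM ?posrE// ler_ln ?posrE ?ltr0n// mulr_gt0.
move=> lnX; apply: le_trans (_ : 1 + (ln b + ln H) <= _); first by rewrite lerD2l.
nra.
Qed.

End Harmonic.

(** * Coprime pairs in residue classes *)

Section CoprimePairs.
Local Open Scope nat_scope.

(** As [M] is invertible modulo [p], the residue of [a] is prescribed, so [a] is determined by the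
    quotient [a %/ p]. *)
Lemma card_residue_le (N Y p x M : nat) : 0 < p -> coprime p M ->
  #|[set a : 'I_Y | (a < N) && (p %| x + M * a)]%SET| <= (N %/ p).+1.
Proof.
move=> p0 cpM; set C := [set a | _]%SET.
rewrite cardE -(size_map (fun a : 'I_Y => a %/ p)) -(size_iota 0 (N %/ p).+1).
apply: uniq_leq_size; last first.
  move=> _ /mapP[a + ->]; rewrite mem_enum finset.inE => /andP[aN _].
  by rewrite mem_iota add0n ltnS leq_div2r// ltnW.
rewrite map_inj_in_uniq ?enum_uniq// => a b; rewrite !mem_enum !finset.inE.
move=> /andP[_ pa] /andP[_ pb] q; apply: ord_inj.
wlog ab : a b pa pb q / b <= a.
  move=> H; case: (leqP b a) => [ab|/ltnW ba]; first exact: H.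
  by apply/esym/H.
have pd : p %| a - b.
  have : p %| M * (a - b).
    have -> : M * (a - b) = (x + M * a) - (x + M * b) by rewrite mulnBr; lia.
    exact: dvdn_sub.
  by rewrite Gauss_dvdr.
have /eqP e : a == b %[mod p] by rewrite eqn_mod_dvd.
by rewrite (divn_eq a p) (divn_eq b p) q e.
Qed.

Lemma card_noncoprime_le (N Y v0 M : nat) : 0 < M -> 210 %| M -> v0 <= M ->
  #|[set x : 'I_Y * 'I_Y | [&& x.1 < N, x.2 < N & ~~ coprime (1 + M * x.1) (v0 + M * x.2)]]%SET|
  <= \sum_(11 <= p < (M * N).+1) (N %/ p).+1 ^ 2.
Proof.
move=> M0 M210 v0M; set B := [set x | _]%SET.
pose C p x := [set a : 'I_Y | (a < N) && (p %| x + M * a)]%SET.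
pose P (p : 'I_(M * N).+1) := (11 <= p) && coprime p M.
have sub : B \subset (\bigcup_(p | P p) finset.setX (C p 1) (C p v0))%SET.
  apply/fintype.subsetP => -[a b]; rewrite finset.inE /= => /and3P[aN bN].
  set g := gcdn (1 + M * a) (v0 + M * b) => ng.
  have g1 : 1 < g.
    rewrite ltn_neqAle gcdn_gt0 addn_gt0 /= andbT.
    by rewrite eq_sym; apply: contra ng => /eqP e; rewrite /coprime -/g e.
  pose p := pdiv g; have p_pr : prime p := pdiv_prime g1.
  have pg : p %| g := pdiv_dvd g.
  have pa : p %| 1 + M * a := dvdn_trans pg (dvdn_gcdl _ _).
  have pb : p %| v0 + M * b := dvdn_trans pg (dvdn_gcdr _ _).
  (* A common factor of [p] and [M] is impossible because [p] divides [1 + M * a]; this is where the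
     residue 1 of $u$ enters. *)
  have pM : coprime p M.
    rewrite prime_coprime//; apply/negP => pM.
    have : p %| 1 by rewrite -(dvdn_addl _ (dvdn_mulr a pM)).
    by rewrite dvdn1 => /eqP p1; move: p_pr; rewrite p1.
  have p11 : 11 <= p.
    have p210 : coprime p 210 by exact: coprime_dvdr pM.
    move: p_pr p210; rewrite leqNgt; case: (p) => [|[|[|[|[|[|[|[|[|[|[|]]]]]]]]]]] //.
  have pMN : p < (M * N).+1.
    have := dvdn_leq (ltn0Sn _) pa; rewrite ltnS => le; apply: leq_trans le _.
    by apply: leq_trans (_ : M * a.+1 <= _); [rewrite mulnS; lia | rewrite leq_mul2l aN orbT].
  apply/finset.bigcupP; exists (Ordinal pMN); first by rewrite /P /= p11.
  by rewrite !finset.inE /= aN bN pa pb.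
apply: leq_trans (subset_leq_card sub) _.
apply: leq_trans (_ : \sum_(p | P p) #|finset.setX (C p 1) (C p v0)| <= _).
  elim/big_rec2: _ => [|p y A _ IH]; first by rewrite cards0.
  by apply: leq_trans (leq_card_setU _ _) _; rewrite leq_add2l.
apply: leq_trans (_ : \sum_(p | P p) (N %/ p).+1 ^ 2 <= _).
  apply: leq_sum => p /andP[p11 cpM]; rewrite finset.cardsX -mulnn.
  by apply: leq_mul; apply: card_residue_le => //; exact: leq_trans p11.
rewrite (big_nat_widenl 11 0)// big_mkord.
rewrite [leqRHS](bigID (fun p : 'I_(M * N).+1 => coprime p M)) /=.
by apply: leq_trans (leq_addr _ _); apply: eq_leq; apply: eq_bigl.
Qed.

End CoprimePairs.

(** Telescoping, from $1/p^2 \le 1/(p-1) - 1/p$. *)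
Lemma sum_inv_sqr_le (R : realFieldType) (m : nat) :
  \sum_(11 <= p < m) ((p%:R : R) ^+ 2)^-1 <= 10^-1.
Proof.
have [le|lt] := leqP m 11; first by rewrite big_geq// invr_ge0.
suff H k : \sum_(11 <= p < (11 + k)%N) ((p%:R : R) ^+ 2)^-1 <= 10^-1 - (10 + k)%N%:R^-1.
  rewrite -(subnKC (ltnW lt)); apply: le_trans (H _) _.
  by rewrite lerBlDr lerDl invr_ge0.
elim: k => [|k IH]; first by rewrite addn0 big_geq// addn0 subrr.
rewrite addnS big_nat_recr ?leq_addr//=; apply: le_trans (lerD IH (lexx _)) _.
set y : R := (10 + k)%N%:R; have y0 : 0 < y by rewrite ltr0n addSn.
have -> : (11 + k)%N%:R = y + 1 :> R by rewrite natr1.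
have : 0 <= y^-1 - (y + 1)^-1 - ((y + 1) ^+ 2)^-1.
  rewrite (_ : _ - _ = (y * (y + 1) ^+ 2)^-1); last by field; lra.
  by rewrite invr_ge0 mulr_ge0 ?exprn_ge0 ?ltW// addr_gt0.
by lra.
Qed.

(* As [210 %| M], a common prime factor of [1 + M * a] and [v0 + M * b] is at
   least 11, and the sum of [1 / p ^ 2] over [p >= 11] is at most 1/10. *)
Lemma coprime_pairs_count (N Y v0 M : nat) : (0 < M)%N -> (210 %| M)%N ->
  (v0 <= M)%N -> (7 * M <= N)%N -> (N <= Y)%N ->
  (N ^ 2 <= 2 * #|[set x : 'I_Y * 'I_Y |
     [&& (x.1 < N)%N, (x.2 < N)%N & coprime (1 + M * x.1) (v0 + M * x.2)]]%SET|)%N.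
Proof.
move=> M0 M210 v0M NM NY; pose R : realFieldType := rat; set G := [set x | _]%SET.
pose B := [set x : 'I_Y * 'I_Y |
     [&& (x.1 < N)%N, (x.2 < N)%N & ~~ coprime (1 + M * x.1) (v0 + M * x.2)]]%SET.
have GB : (N ^ 2 = #|G| + #|B|)%N.
  pose I := [set a : 'I_Y | (a < N)%N]%SET.
  have cI : #|I| = N.
    have -> : I = [set widen_ord NY a | a in 'I_N]%SET.
      apply/setP => a; rewrite finset.inE; apply/idP/imsetP => [aN|[b _ ->]] /=; last exact: ltn_ord.
      by exists (Ordinal aN) => //; apply: ord_inj.
    rewrite finset.card_imset ?card_ord// => a b /(congr1 val) /= e.
    exact: ord_inj.
  rewrite -mulnn -{1 2}cI -finset.cardsX -finset.cardsUI.
  rewrite (_ : G :&: B = finset.set0)%SET ?cards0 ?addn0; last first.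
    by apply/setP => x; rewrite !finset.inE; case: (x.1 < N)%N; case: (x.2 < N)%N; case: (coprime _ _).
  congr #|pred_of_set _|; apply/setP => x; rewrite !finset.inE.
  by case: (x.1 < N)%N; case: (x.2 < N)%N; case: (coprime _ _).
(* From $(q+1)^2 \le 2q^2 + 2$ one gets $|B| \le N^2/5 + 2MN$. Once $7M \le N$ this is at most $(1/5
   + 2/7)N^2 = 17N^2/35$, less than half; hence the constant 7. *)
have Bub : (5 * (#|B|%:R : R) <= N%:R ^+ 2 + 10 * (M * N)%:R).
  apply: le_trans (_ : 5 * (\sum_(11 <= p < (M * N).+1) (N %/ p).+1 ^ 2)%:R <= _).
    by rewrite ler_wpM2l// ler_nat card_noncoprime_le.
  apply: le_trans (_ : 5 * (2 * N%:R ^+ 2 * 10^-1 + 2 * (M * N)%:R) <= _); last by lra.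
  rewrite ler_wpM2l// natr_sum.
  apply: le_trans (_ : \sum_(11 <= p < (M * N).+1) (2 * N%:R ^+ 2 * ((p%:R : R) ^+ 2)^-1 + 2) <= _).
    rewrite big_nat [leRHS]big_nat; apply: ler_sum => p /andP[p11 _].
    have p0 : 0 < p%:R :> R by rewrite ltr0n; lia.
    rewrite natrX -natr1; set q : R := (N %/ p)%:R.
    have qN : q * p%:R <= N%:R by rewrite -natrM ler_nat leq_trunc_div.
    have q0 : 0 <= q by rewrite ler0n.
    apply: le_trans (_ : 2 * q ^+ 2 + 2 <= _).
      by have := sqr_ge0 (q - 1); lra.
    rewrite lerD2r -mulrA ler_wpM2l// ler_pdivlMr ?exprn_gt0// -exprMn.
    by rewrite lerXn2r ?nnegrE ?mulr_ge0 ?ler0n.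
  rewrite big_split /= -mulr_sumr lerD//.
    by rewrite ler_wpM2l ?mulr_ge0 ?exprn_ge0 ?ler0n// sum_inv_sqr_le.
  by rewrite sumr_const_nat -[leLHS]mulr_natr ler_wpM2l// ler_nat; lia.
have GBR : N%:R ^+ 2 = #|G|%:R + #|B|%:R :> R by rewrite -natrX GB natrD.
rewrite -(ler_nat R) natrX natrM.
have MN : 7 * M%:R <= N%:R :> R by rewrite -natrM ler_nat.
rewrite natrM in Bub; have N0 : 0 <= N%:R :> R by rewrite ler0n.
nra.
Qed.

(** * Lower bound *)

Lemma exists_isqrt (m : nat) : exists s, (s ^ 2 <= m < s.+1 ^ 2)%N.
Proof.
have ex0 : exists s, (s ^ 2 <= m)%N by exists 0%N.
have ub s : (s ^ 2 <= m)%N -> (s <= m)%N by case: s => // s; nia.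
case: (ex_maxnP ex0 ub) => s sm smax; exists s; rewrite sm /= ltnNge.
by apply/negP => /smax; rewrite ltnn.
Qed.

(** Coprimality gives $\gcd(du^2, dv^2) = d$, so $d$ is read off first. *)
Lemma square_scaling_inj (d u v d' u' v' : nat) : (0 < d)%N -> (0 < d')%N ->
  coprime u v -> coprime u' v' ->
  (d * u ^ 2 = d' * u' ^ 2)%N -> (d * v ^ 2 = d' * v' ^ 2)%N -> [/\ d = d', u = u' & v = v'].
Proof.
move=> d0 d0' cuv cuv' eu ev.
have g (e a b : nat) : coprime a b -> gcdn (e * a ^ 2) (e * b ^ 2) = e.
  move=> cab; rewrite -muln_gcdr; have /eqP -> : coprime (a ^ 2) (b ^ 2).
    by apply/coprimeXl/coprimeXr.
  by rewrite muln1.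
have dd : d = d' by rewrite -(g d u v cuv) eu ev g.
move: eu ev; rewrite -dd => /eqP; rewrite eqn_pmul2l// eqn_exp2r// => /eqP ->.
by move=> /eqP; rewrite eqn_pmul2l// eqn_exp2r// => /eqP ->.
Qed.

Lemma Posz_sqr (m : nat) : m%:Z ^+ 2 = (m ^ 2)%N%:Z.
Proof. by rewrite expr2 -PoszM mulnn. Qed.

Lemma square_family_bound (Q : {poly int}) (d u v q B : nat) :
  (forall i, absz (Q`_i)%R <= q)%N -> (d * u ^ 2 <= B)%N -> (d * v ^ 2 <= B)%N ->
  forall i, (absz ((square_family Q d%:Z u%:Z v%:Z)`_i)%R <= 5 * q + 5 * B)%N.
Proof.
move=> Qq uB vB i.
have tri (x y : int) : (absz (x + y)%R <= absz x + absz y)%N.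
  by rewrite -lez_nat PoszD !abszE ler_normD.
rewrite /square_family mulrBl !coefD coefN coefXnM coefCM coefZ coefX coefC.
have h1 : (absz (if (i < 2)%N then 0%R else (Q`_(i - 2))%R : int) <= q)%N by case: ifP.
have h2 : (absz (4 * Q`_i)%R <= 4 * q)%N by rewrite abszM leq_mul2l Qq orbT.
have h3 : (absz (d%:Z * (u%:Z ^+ 2 - v%:Z ^+ 2) * (i == 1%N)%:R)%R <= B)%N.
  have -> : d%:Z * (u%:Z ^+ 2 - v%:Z ^+ 2) = (d * u ^ 2)%N%:Z - (d * v ^ 2)%N%:Z.
    by rewrite !PoszM; ring.
  by case: (i == 1%N); rewrite ?mulr0// mulr1; lia.
have h4 : (absz (if i == 0%N then 2 * d%:Z * (u%:Z ^+ 2 + v%:Z ^+ 2) else 0)%R <= 4 * B)%N.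
  have -> : 2 * d%:Z * (u%:Z ^+ 2 + v%:Z ^+ 2) = (2 * (d * u ^ 2 + d * v ^ 2))%N%:Z.
    by rewrite PoszM PoszD !PoszM; ring.
  by case: ifP => _; rewrite ?absz0 ?absz_nat//; lia.
apply: leq_trans (tri _ _) _; apply: leq_trans (leq_add (tri _ _) h4) _.
apply: leq_trans (leq_add (leq_add (tri _ _) h3) (leqnn _)) _; rewrite abszN.
apply: leq_trans (leq_add (leq_add (leq_add h1 h2) (leqnn _)) (leqnn _)) _.
by lia.
Qed.

Section LowerBound.
Variables (n k M d0 v0 : nat) (Q0 : {poly int}).
Hypotheses (M210 : (210 %| M)%N) (M0 : (0 < M)%N).
Hypotheses (d0M : (0 < d0 <= M)%N) (v0M : (0 < v0 <= M)%N).

(** The [k] lowest coefficients of $Q$ move in their classes modulo [M]. For [n >= 2], with [Q0]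
    monic of degree [n - 2], [k = n.-1] moves the leading one too, and [k = n.-2] keeps the
    polynomial monic. *)
Definition family_member (c : nat -> nat) (j a b : nat) : {poly int} :=
  square_family (Q0 + M%:Z *: \sum_(i < k) (c i)%:Z *: 'X^i)
    (d0 + M * j)%N%:Z (1 + M * a)%N%:Z (v0 + M * b)%N%:Z.

Hypothesis size_family : forall c j a b, coprime (1 + M * a) (v0 + M * b) ->
  size (family_member c j a b) = n.+1.

Lemma family_member_inj (c c' : nat -> nat) (j j' a a' b b' : nat) :
  coprime (1 + M * a) (v0 + M * b) -> coprime (1 + M * a') (v0 + M * b') ->
  reciprocal_lift n (family_member c j a b) = reciprocal_lift n (family_member c' j' a' b') ->
  [/\ forall i, (i < k)%N -> c i = c' i, j = j', a = a' & b = b'].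
Proof.
move=> cop cop' /reciprocal_lift_inj; rewrite !size_family// => /(_ (leqnn _) (leqnn _)) e.
have d00 i : (0 < d0 + M * i)%N by lia.
pose Qc (c : nat -> nat) := Q0 + M%:Z *: \sum_(i < k) (c i)%:Z *: 'X^i.
have [h2 hm2] := horner_square_family (Qc c) (d0 + M * j)%N%:Z (1 + M * a)%N%:Z (v0 + M * b)%N%:Z.
have [h2' hm2'] := horner_square_family (Qc c') (d0 + M * j')%N%:Z (1 + M * a')%N%:Z (v0 + M * b')%N%:Z.
have nat_eq (x y z t : nat) : 4 * x%:Z * y%:Z ^+ 2 = 4 * z%:Z * t%:Z ^+ 2 -> (x * y ^ 2 = z * t ^ 2)%N.
  rewrite -!mulrA => /(mulfI _) h; have := h isT; rewrite !Posz_sqr -!PoszM.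
  by case.
have eu : ((d0 + M * j) * (1 + M * a) ^ 2 = (d0 + M * j') * (1 + M * a') ^ 2)%N.
  by apply: nat_eq; rewrite -h2 -h2' -[Qc c]/(Qc c); congr horner.
have ev : ((d0 + M * j) * (v0 + M * b) ^ 2 = (d0 + M * j') * (v0 + M * b') ^ 2)%N.
  by apply: nat_eq; rewrite -hm2 -hm2'; congr horner.
have [dd uu vv] := square_scaling_inj (d00 j) (d00 j') cop cop' eu ev.
have inj x y z : (z + M * x = z + M * y)%N -> x = y.
  by move=> /addnI /eqP; rewrite eqn_pmul2l// => /eqP.
have jj := inj _ _ _ dd; have aa := inj _ _ _ uu; have bb := inj _ _ _ vv.
split=> // i ik; move: e; rewrite /family_member dd uu vv => /addIr /addIr.
have D0 : 'X^2 - 4%:P != 0 :> {poly int} by rewrite monic_neq0// monicXnsubC.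
move=> /(mulfI D0) /addrI e.
have Mz : M%:Z != 0 by rewrite eqz_nat -lt0n.
have := congr1 (fun p : {poly int} => p`_(Ordinal ik)) e.
by rewrite !coefZ !coef_sumZXn => /(mulfI Mz) [].
Qed.

(** For each [j] at least half of the [Nj j ^ 2] pairs give coprime values, which is the factor 2;
    [Y ^ k] counts the free coefficients, and [family_member_inj] excludes repetitions. *)
Lemma family_count (N Y J : nat) (S : set {poly int}) (Nj : nat -> nat) :
  finite_set S ->
  (forall j, (j < J)%N -> (7 * M <= Nj j)%N /\ (Nj j <= Y)%N) ->
  (forall c j a b, (j < J)%N -> (forall i, (c i < Y)%N) -> (a < Nj j)%N -> (b < Nj j)%N ->
     coprime (1 + M * a) (v0 + M * b) -> S (reciprocal_lift n (family_member c j a b))) ->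
  (Y ^ k * \sum_(j < J) Nj j ^ 2 <= 2 * #|` fset_set S|%fset)%N.
Proof.
move=> Sfin NjP inS.
pose P (j : nat) := [set x : 'I_Y * 'I_Y |
   [&& (x.1 < Nj j)%N, (x.2 < Nj j)%N & coprime (1 + M * x.1) (v0 + M * x.2)]]%SET.
pose A := [set x : {ffun 'I_k -> 'I_Y} * ('I_J * ('I_Y * 'I_Y)) | x.2.2 \in P x.2.1]%SET.
have cardA : #|A| = (Y ^ k * \sum_(j < J) #|P j|)%N.
  pose A' := [set x : 'I_J * ('I_Y * 'I_Y) | x.2 \in P x.1]%SET.
  have -> : A = finset.setX [set: {ffun 'I_k -> 'I_Y}]%SET A'.
    by apply/setP => x; rewrite !finset.inE.
  rewrite finset.cardsX cardsT card_ffun !card_ord; congr (_ * _)%N.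
  rewrite -sum1_card; transitivity (\sum_(j < J) \sum_(y in P j) 1)%N; last first.
    by apply: eq_bigr => j _; rewrite sum1_card.
  by rewrite pair_big_dep /=; apply: eq_bigl => -[j y]; rewrite !finset.inE.
have le : (Y ^ k * \sum_(j < J) Nj j ^ 2 <= 2 * #|A|)%N.
  rewrite cardA mulnCA leq_mul2l big_distrr /=; apply/orP; right.
  apply: leq_sum => j _; have [h1 h2] := NjP j (ltn_ord j).
  by apply: coprime_pairs_count => //; case/andP: v0M.
apply: leq_trans le _; rewrite leq_mul2l /=.
pose ext (c : {ffun 'I_k -> 'I_Y}) (i : nat) : nat := if insub i is Some o then c o else 0%N.
have extE c (i : 'I_k) : ext c i = c i.
  by rewrite /ext valK.
apply: (card_fset_set_ge (h := fun x : {ffun 'I_k -> 'I_Y} * ('I_J * ('I_Y * 'I_Y)) =>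
  reciprocal_lift n (family_member (ext x.1) x.2.1 x.2.2.1 x.2.2.2))) => //.
  move=> [c [j [a b]]]; rewrite !finset.inE /= => /and3P[aN bN cop].
  apply: inS => // i; rewrite /ext; case: insubP => // _.
  by have [_ h] := NjP j (ltn_ord j); lia.
move=> [c [j [a b]]] [c' [j' [a' b']]]; rewrite !finset.inE /= => /and3P[_ _ cop] /and3P[_ _ cop'].
move/(family_member_inj cop cop') => -[cc jj aa bb].
have -> : c = c' by apply/ffunP => i; apply: ord_inj; rewrite -!extE cc.
by rewrite (ord_inj jj) (ord_inj aa) (ord_inj bb).
Qed.

End LowerBound.

Section LowerAsymptotic.
Variables (R : realType) (n k M d0 v0 : nat) (Q0 : {poly int}) (S : R -> set {poly int}).
Hypotheses (M210 : (210 %| M)%N) (M0 : (0 < M)%N).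
Hypotheses (d0M : (0 < d0 <= M)%N) (v0M : (0 < v0 <= M)%N).
Hypothesis size_family : forall c j a b, coprime (1 + M * a) (v0 + M * b) ->
  size (family_member k M d0 v0 Q0 c j a b) = n.+1.
Hypothesis Sfin : forall H, finite_set (S H).
Hypothesis inS : forall H c j a b, coprime (1 + M * a) (v0 + M * b) ->
  let f := reciprocal_lift n (family_member k M d0 v0 Q0 c j a b) in
  (forall i, `|(f`_i)%:~R| <= H) -> S H f.

(** Here $d \le M(j+1)$ and $u, v \le MN$, so $(j+1)N^2 \le Y$ bounds $du^2$ and $dv^2$ by $M^3 Y$,
    and all coefficients stay linear in $Y$. *)
Lemma family_coef_bound : exists2 D : nat, (0 < D)%N &
  forall (Y N c_j a b : nat) (c : nat -> nat), (0 < Y)%N -> (forall i, (c i < Y)%N) ->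
  (c_j.+1 * N ^ 2 <= Y)%N -> (a < N)%N -> (b < N)%N ->
  forall i, (absz ((reciprocal_lift n (family_member k M d0 v0 Q0 c c_j a b))`_i)%R <= D * Y)%N.
Proof.
have [C CP] := reciprocal_lift_bound n.
pose q0 := (\max_(i < size Q0) absz (Q0`_i)%R)%N.
exists (C * (5 * (q0 + M) + 5 * M ^ 3)).+1 => // Y N j a b c Y0 cY jN aN bN i.
apply: leq_trans (CP _ (5 * (q0 + M * Y) + 5 * (M ^ 3 * Y)) _ i)%N _; last by nia.
have q0P l : (absz (Q0`_l)%R <= q0)%N.
  have [ll|lg] := ltnP l (size Q0); last by rewrite nth_default.
  exact: (@leq_bigmax _ (fun i : 'I_(size Q0) => absz (Q0`_i)%R) (Ordinal ll)).
have bnd x y : (x < N)%N -> (y <= M)%N -> ((d0 + M * j) * (y + M * x) ^ 2 <= M ^ 3 * Y)%N.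
  move=> xN yM; apply: leq_trans (_ : (M * j.+1 * (M * N) ^ 2 <= _)%N).
    apply: leq_mul; first by rewrite mulnS leq_add2r; case/andP: d0M.
    rewrite leq_exp2r//; apply: leq_trans (_ : M * x.+1 <= _)%N.
      by rewrite mulnS leq_add2r.
    by rewrite leq_mul2l xN orbT.
  rewrite (_ : M * j.+1 * (M * N) ^ 2 = M ^ 3 * (j.+1 * N ^ 2))%N; last by rewrite expnMn; ring.
  by rewrite leq_mul2l jN orbT.
apply: square_family_bound; [|exact: bnd|by apply: bnd => //; case/andP: v0M].
move=> l; rewrite coefD coefZ -(poly_def k (fun i => (c i)%:Z)) coef_poly.
apply: leq_trans (_ : absz (Q0`_l)%R + M * Y <= _)%N; last by rewrite leq_add2r.
rewrite -lez_nat PoszD !abszE; apply: le_trans (ler_normD _ _) _; rewrite lerD2l.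
case: ifP => _; last by rewrite mulr0 normr0.
by rewrite -PoszM ger0_norm// lez_nat leq_mul2l ltnW ?orbT.
Qed.

Lemma lower_asymptotic : exists2 c : R, 0 < c & exists H0 : R, forall H, H0 <= H ->
  c * (H ^+ k.+1 * ln H) <= (#|` fset_set (S H)|%fset)%:R.
Proof.
have [D D0 DP] := family_coef_bound.
(* For [j < Y %/ W] the integer square root of [Y %/ j.+1] is at least [7 * M], the size that
   [coprime_pairs_count] demands. *)
pose W := ((7 * M) ^ 2)%N; have W0 : (0 < W)%N by rewrite expn_gt0 muln_gt0 M0.
pose L : R := (2 * D * W)%N%:R.
have Dr : 1 <= D%:R :> R by rewrite ler1n.
have Wr : 1 <= W%:R :> R by rewrite ler1n.
have LE : L = 2 * D%:R * W%:R by rewrite /L !natrM.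
have L2D : 2 * D%:R <= L by rewrite LE ler_peMr// mulr_ge0// ler0n.
have L1 : 1 <= L by lra.
(* $Y \ge H/(2D)$ accounts for the power. The 16 combines 4 from [Nj j ^ 2] against $Y/(j+1)$, 2
   from the logarithm and 2 from coprimality. *)
exists ((2 * D%:R)^-1 ^+ k.+1 / 16).
  by rewrite divr_gt0// exprn_gt0// invr_gt0; lra.
(* For $H \ge L^2$ one has $\ln(H/L) \ge (\ln H)/2$, while $H/L \le J + 1$. *)
exists (L ^+ 2) => H HL.
have LH : L <= H by apply: le_trans HL; rewrite expr2 ler_peMr//; lra.
have H0 : 0 < H by lra.
pose Y := Num.truncn (H / D%:R).
have Dp : 0 < D%:R :> R by lra.
have YH : Y%:R * D%:R <= H by rewrite -ler_pdivlMr// truncn_le// divr_ge0// ltW.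
have Y0 : (0 < Y)%N by rewrite truncn_gt0 ler_pdivlMr//; lra.
have HY : H / (2 * D%:R) <= Y%:R.
  have : H / D%:R < Y.+1%:R by exact: truncnS_gt.
  rewrite ltr_pdivrMr// -natr1 => h; rewrite ler_pdivrMr; last by lra.
  have : 1 <= Y%:R :> R by rewrite ler1n.
  by move=> Y1; nra.
have [Nj NjP] := boolp.choice (fun j => exists_isqrt (Y %/ j.+1)).
pose J := (Y %/ W)%N.
have NjY j : (j.+1 * Nj j ^ 2 <= Y)%N.
  by have /andP[h _] := NjP j; rewrite mulnC -leq_divRL.
have Nj7 j : (j < J)%N -> (7 * M <= Nj j)%N.
  move=> jJ; have /andP[_ h] := NjP j.
  rewrite -ltnS -(@ltn_exp2r _ _ 2)//; apply: leq_ltn_trans h.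
  by rewrite leq_divRL// mulnC -leq_divRL// (leq_trans jJ).
have cnt : (Y ^ k * \sum_(j < J) Nj j ^ 2 <= 2 * #|` fset_set (S H)|%fset)%N.
  apply: (@family_count n k M d0 v0 Q0) => //.
    move=> j jJ; split; first exact: Nj7.
    apply: leq_trans (NjY j); rewrite mulSn; apply: leq_trans (leq_addr _ _).
    by case: (Nj j) => // m; rewrite -mulnn leq_pmulr.
  move=> c j a b jJ cY aN bN cop; apply: inS => // i.
  have := DP Y (Nj j) j a b c Y0 cY (NjY j) aN bN i.
  rewrite -(ler_nat R) natrM mulrC => /le_trans/(_ YH).
  by rewrite -intr_norm pmulrn abszE.
have NjR (j : nat) : (j < J)%N -> Y%:R / 4 * (j.+1%:R)^-1 <= (Nj j ^ 2)%:R :> R.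
  move=> jJ; rewrite ler_pdivrMr ?ltr0n// ler_pdivrMr// -natrM -natrM ler_nat.
  have /andP[_ h] := NjP j.
  have N0 : (0 < Nj j)%N by apply: leq_trans (Nj7 j jJ); rewrite muln_gt0 M0.
  have lt : (Y < j.+1 * (Nj j).+1 ^ 2)%N by rewrite mulnC -ltn_divLR.
  apply: leq_trans (ltnW lt) _; apply: leq_trans (_ : j.+1 * (2 * Nj j) ^ 2 <= _)%N.
    by rewrite leq_mul2l leq_exp2r//= mul2n -addnn -addn1 leq_add2l.
  by rewrite expnMn (mulnC (2 ^ 2)%N) mulnA (mulnC j.+1).
have sumR : Y%:R / 4 * ln J.+1%:R <= (\sum_(j < J) Nj j ^ 2)%:R :> R.
  apply: le_trans (_ : Y%:R / 4 * (\sum_(1 <= d < J.+1) (d%:R : R)^-1) <= _).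
    by rewrite ler_wpM2l ?divr_ge0 ?ler0n// ln_le_harmonic.
  rewrite big_add1 /= big_mkord mulr_sumr natr_sum; apply: ler_sum => j _.
  exact: NjR (ltn_ord j).
have lnJ : ln H / 2 <= ln J.+1%:R.
  have HLJ : H / L <= J.+1%:R.
    rewrite LE invfM mulrA; apply: le_trans (_ : Y%:R / W%:R <= _).
      by rewrite ler_pM2r// invr_gt0; lra.
    by rewrite ler_pdivrMr ?ltr0n// -natrM ler_nat ltnW// ltn_ceil.
  have lnHL : ln H - ln L <= ln J.+1%:R.
    rewrite -ln_div ?posrE//; last by lra.
    by rewrite ler_ln ?posrE ?ltr0n// divr_gt0//; lra.
  have : 2 * ln L <= ln H.
    have -> : 2 * ln L = ln (L ^+ 2) by rewrite lnXn ?mulr_natl//; lra.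
    by rewrite ler_ln ?posrE// exprn_gt0//; lra.
  by lra.
have lnJ0 : 0 <= ln H by apply: ln_ge0; lra.
have cntR : (Y%:R ^+ k * (Y%:R / 4 * (ln H / 2)) <= 2 * (#|` fset_set (S H)|%fset)%:R :> R).
  apply: le_trans (_ : (Y ^ k * \sum_(j < J) Nj j ^ 2)%:R <= _); last first.
    by rewrite -natrM ler_nat.
  rewrite natrM natrX ler_wpM2l ?exprn_ge0 ?ler0n//.
  by apply: le_trans sumR; rewrite ler_wpM2l ?divr_ge0 ?ler0n.
have YP : (H / (2 * D%:R)) ^+ k.+1 <= Y%:R ^+ k.+1.
  by apply: lerXn2r; rewrite ?nnegrE ?ler0n ?divr_ge0//; lra.
have YL : (H / (2 * D%:R)) ^+ k.+1 * ln H <= Y%:R ^+ k.+1 * ln H by rewrite ler_wpM2r.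
have -> : (2 * D%:R)^-1 ^+ k.+1 / 16 * (H ^+ k.+1 * ln H) =
    (H / (2 * D%:R)) ^+ k.+1 * ln H / 16 by rewrite exprMn; ring.
have cE : Y%:R ^+ k * (Y%:R / 4 * (ln H / 2)) = Y%:R ^+ k.+1 * ln H / 8.
  by rewrite exprSr; field.
rewrite cE in cntR; lra.
Qed.

End LowerAsymptotic.

(** * Assembly: admissible parameters and the two asymptotics *)

Lemma nat_residue (M : nat) (x : int) : (0 < M)%N ->
  exists2 y : nat, (0 < y <= M)%N & (M%:Z %| y%:Z - x)%Z.
Proof.
move=> M0; have M0' : M%:Z != 0 by rewrite eqz_nat -lt0n.
have r0 : 0 <= ((x - 1) %% M)%Z by rewrite modz_ge0.
have rM : ((x - 1) %% M)%Z < M by rewrite ltz_pmod.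
(* The representative is shifted into $1, \dots, M$, away from 0, so that $d$ and $v$ are never
   zero. *)
exists (absz ((x - 1) %% M)%Z).+1.
  by rewrite ltn0Sn /= -ltz_nat gez0_abs.
rewrite intS gez0_abs//; apply/dvdzP; exists (- ((x - 1) %/ M)%Z).
have e := divz_eq (x - 1) M; set r := (_ %% _)%Z in e *; set q := (_ %/ _)%Z in e *.
have -> : 1 + r - x = r - (x - 1) by ring.
by rewrite e; ring.
Qed.

Lemma size_square_family (n : nat) (Q : {poly int}) (d u v : int) : (2 <= n)%N ->
  size Q = n.-1 -> size (square_family Q d u v) = n.+1 /\
  lead_coef (square_family Q d u v) = lead_coef Q.
Proof.
move=> n2 szQ; have Q0 : Q != 0 by rewrite -size_poly_gt0 szQ; case: n n2 {szQ} => [|[]].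
have Dm : ('X^2 - 4%:P : {poly int}) \is monic by exact: monicXnsubC.
have szD : size ('X^2 - 4%:P : {poly int}) = 3 by exact: size_XnsubC.
have szDQ : size (('X^2 - 4%:P) * Q) = n.+1.
  by rewrite size_monicM// szD szQ; case: n n2 {szQ} => [|[]].
rewrite /square_family -addrA; set l := _ *: 'X + _.
have szl : (size l < size (('X^2 - 4%:P) * Q)%R)%N.
  rewrite szDQ ltnS; apply: leq_trans n2; apply: leq_trans (size_polyD _ _) _.
  rewrite geq_max (leq_trans (size_scale_leq _ _)) ?size_polyX//.
  by rewrite (leq_trans (size_polyC_leq1 _)).
by rewrite size_polyDl// lead_coefDl// lead_coef_monicM.
Qed.

Lemma asymp_of_bounds (R : realType) (A : R -> nat) (k : nat) :
  (exists2 c : R, 0 < c & exists H0 : R, forall H, H0 <= H -> c * (H ^+ k * ln H) <= (A H)%:R) ->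
  (exists2 c : R, 0 < c & forall H, expR 1 <= H -> (A H)%:R <= c * (H ^+ k * ln H)) ->
  asymp (fun H : R => (A H)%:R) (fun H : R => H ^+ k * ln H).
Proof.
move=> [c1 c10 [H0 lo]] [c2 c20 up]; exists c1, c2; split=> //.
exists (Num.max H0 (expR 1)) => H; rewrite ge_max => /andP[HH0 He].
have H1 : 1 <= H by apply: le_trans He; rewrite -[X in X <= _]expR0 ler_expR.
rewrite !ger0_norm ?ler0n ?mulr_ge0 ?ln_ge0 ?exprn_ge0//; last exact: le_trans H1.
by split; [exact: lo | exact: up].
Qed.

Lemma separable_linear (g : {poly int}) : size g = 2 -> separableZ g.
Proof.
move=> szg; apply: irreducible_rat_separable.
have szq : size (map_poly intr g : {poly rat}) = 2.
  by rewrite size_map_inj_poly ?rmorph0//; exact: intr_inj.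
split; first by rewrite szq.
move=> q q1 qg; rewrite -dvdp_size_eqp// szq eqn_leq.
have g0 : map_poly intr g != 0 :> {poly rat} by rewrite -size_poly_gt0 szq.
have := dvdp_leq g0 qg; rewrite szq => -> /=.
have : q != 0 by apply: contraTneq qg => ->; rewrite dvd0p.
by rewrite -size_poly_gt0; case: (size q) q1 => [|[]].
Qed.

Lemma galois_group_S1 (g : {poly int}) : size g = 2 -> galois_group_is_Sn 1 g.
Proof.
move=> szg; have [z zI gz] := separable_roots_in_C szg (separable_linear szg).
have a0 : lead_coef g != 0 by rewrite lead_coef_eq0 -size_poly_eq0 szg.
have [L [iota [r [gL rg _ _]]]] := splitting_field_in_C a0 zI gz.
exists L, r; split=> //; apply/setP => s; rewrite finset.in_setT.
have -> : s = 1%g by apply/permP => i; rewrite !ord1.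
exact: (group1 (group (galperm_group_set rg.1))).
Qed.

(* For [n = 1] the group is trivial, and the only condition is [u != v]. *)
Lemma full_group_family (n k : nat) : (0 < n)%N -> (k <= n.-1)%N ->
  exists (M d0 v0 : nat) (Q0 : {poly int}),
  [/\ (210 %| M)%N, (0 < M)%N, (0 < d0 <= M)%N, (0 < v0 <= M)%N &
   forall c j a b, let g := family_member k M d0 v0 Q0 c j a b in
   [/\ size g = n.+1, separableZ g, galois_group_is_Sn n g
     & (k < n.-1)%N -> lead_coef g = 1]].
Proof.
case: n => [//|[|n']] _ kn.
  have -> : k = 0%N by move: kn; case: k.
  exists 210%N, 1%N, 2, 0; split=> // c j a b g.
  suff szg : size g = 2 by split=> //; [exact: separable_linear | exact: galois_group_S1].
  rewrite /g /family_member big_ord0 scaler0 addr0 /square_family mulr0 add0r.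
  set x := _ * (_ - _); set y := 2 * _ * _.
  have x0 : x != 0.
    rewrite mulf_neq0//.
    rewrite subr_eq0 eqf_sqr negb_or; apply/andP; split; lia.
  rewrite -mul_polyC size_MXaddC polyC_eq0 (negPf x0) /= size_polyC x0.
  by [].
set n := n'.+2; have n2 : (2 <= n)%N by [].
have [M' [Q0 [d0' [v0' [M0' Q0m szQ0 good]]]]] := good_residues n2.
(* [M'] fixes the Galois group, and 210 serves the count of coprime pairs. *)
pose M := (210 * M')%N; have M0 : (0 < M)%N by rewrite muln_gt0.
have MM : (M'%:Z %| M%:Z)%Z by rewrite dvdzE /= dvdn_mull.
have [d0 d0M dd] := nat_residue d0' M0; have [v0 v0M vv] := nat_residue v0' M0.
exists M, d0, v0, Q0; split=> //; first by rewrite dvdn_mulr.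
move=> c j a b g.
pose Q := Q0 + M%:Z *: \sum_(i < k) (c i)%:Z *: 'X^i.
have QE i : Q`_i = Q0`_i + M%:Z * (if (i < k)%N then (c i)%:Z else 0).
  by rewrite coefD coefZ -(poly_def k (fun i => (c i)%:Z)) coef_poly.
have Qtop : Q`_n' = 1 + M%:Z * (if (n' < k)%N then (c n')%:Z else 0).
  by rewrite QE -[in X in _ = X + _](monicP Q0m) lead_coefE szQ0.
have szQ : size Q = n.-1.
  apply/eqP; rewrite eqn_leq; apply/andP; split.
    apply/leq_sizeP => i ige; rewrite QE nth_default ?szQ0// ltnNge (leq_trans kn ige) /=.
    by rewrite mulr0.
  rewrite ltnNge; apply/negP => le; have : Q`_n' = 0 by rewrite nth_default.
  rewrite Qtop => /eqP; rewrite gt_eqF// ltr_pwDl//; case: ifP => _; rewrite ?mulr0//.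
have [szg leadg] := size_square_family (d0 + M * j)%N%:Z (1 + M * a)%N%:Z (v0 + M * b)%N%:Z n2 szQ.
have dvM (x : int) : (M'%:Z %| M%:Z * x)%Z by exact: dvdz_mulr.
have [sg Sg] : separableZ g /\ galois_group_is_Sn n g.
  apply: good => //.
  - by move=> i; rewrite QE addrC addKr.
  - by rewrite PoszD addrAC PoszM rpredD//; exact: dvdz_trans dd.
  - by rewrite PoszD addrC addKr PoszM.
  - by rewrite PoszD addrAC PoszM rpredD//; exact: dvdz_trans vv.
split=> // kn'; rewrite leadg lead_coefE szQ /= Qtop ltnNge (_ : k <= n')%N ?mulr0 ?addr0//.
Qed.

Theorem theorem4p1 (R : realType) :
  (forall n : nat, (1 <= n)%N ->
     asymp (fun H : R => (E (G1 n) H)%:R) (fun H : R => H ^+ n * ln H)) /\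
  (forall n : nat, (2 <= n)%N ->
     asymp (fun H : R => (Emonic (G1 n) H)%:R)
           (fun H : R => H ^+ (n - 1) * ln H)).
Proof.
have fam_E n M d0 v0 (k : nat) Q0 (H : R) c j a b :
    (210 %| M)%N -> (0 < M)%N -> (0 < d0 <= M)%N -> (0 < v0 <= M)%N ->
    let g := family_member k M d0 v0 Q0 c j a b in
    size g = n.+1 -> separableZ g -> galois_group_is_Sn n g ->
    (forall i, `|((reciprocal_lift n g)`_i)%:~R| <= H) -> Eset (G1 n) H (reciprocal_lift n g).
  move=> M210 M0 /andP[d00 _] /andP[v00 _] g szg sg Sg gH.
  by apply: Eset_square_family => //; rewrite eqz_nat -lt0n addn_gt0 ?d00 ?v00.
split=> [n n1|n n2].
  have [M [d0 [v0 [Q0 [M210 M0 d0M v0M fam]]]]] := full_group_family n1 (leqnn n.-1).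
  have -> : (fun H : R => H ^+ n * ln H) = (fun H => H ^+ n.-1.+1 * ln H) by rewrite prednK.
  apply: asymp_of_bounds.
    apply: (@lower_asymptotic R n n.-1 M d0 v0 Q0 (fun H => Eset (G1 n) H)) => //.
    - by move=> c j a b _; case: (fam c j a b).
    - by move=> H; exact: finite_Eset.
    - by move=> H c j a b _ f fH; have [? ? ? _] := fam c j a b; exact: fam_E.
  apply: (@upper_asymptotic R n 0 n.-1) => //.
  - by move=> H; exact: finite_Eset.
  - by move=> H f [? ? _ ? [_ ?]]; split.
have n0 : (0 < n)%N by exact: leq_trans n2.
have kn : (n.-2 < n.-1)%N by case: n n2 {n0} => [|[]].
have [M [d0 [v0 [Q0 [M210 M0 d0M v0M fam]]]]] := full_group_family n0 (ltnW kn).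
have -> : (n - 1 = n.-2.+1)%N by case: n n2 {n0 kn fam} => [|[|m]]//; rewrite subn1.
apply: asymp_of_bounds.
  apply: (@lower_asymptotic R n n.-2 M d0 v0 Q0 (fun H => Eset_monic (G1 n) H)) => //.
  - by move=> c j a b _; case: (fam c j a b).
  - by move=> H; exact: finite_Eset_monic.
  - move=> H c j a b _ f fH; have [szg sg Sg lg] := fam c j a b; split; first exact: fam_E.
    have g0 : family_member n.-2 M d0 v0 Q0 c j a b != 0 by rewrite -size_poly_eq0 szg.
    by rewrite monicE (size_reciprocal_lift g0 _).2 ?szg// lg.
apply: (@upper_asymptotic R n 1 n.-2) => //.
- by case: n n2 {n0 kn fam} => [|[]].
- by move=> H; exact: finite_Eset_monic.
- by move=> H f [[? ? _ ? [_ ?]] _]; split.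
(* By symmetry the constant coefficient equals the leading one; this is the single fixed coefficient
   ([l = 1]) that lowers the exponent to $n - 1$. *)
have top H f : Eset_monic (G1 n) H f -> f`_0 = 1.
  move=> [[szf rf _ _ _] /monicP fm].
  by rewrite -(reciprocal_coef szf rf (leq0n _)) subn0 -fm lead_coefE szf.
by move=> H f f' i /top f0 /top f'0; rewrite ltnS leqn0 => /eqP ->; rewrite f0 f'0.
Qed.
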